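(* Assume $L$ is a nontrivially Finslerian metric belonging to Class 5 (as defined in the context); in particular $a_1a_4-a_2a_3\neq0$. Then: 1. There hold the relations $$a_5=0,\qquad R_{rt}-R_{tr}=a_1+a_4.$$ In particular, the symmetry of the connection Ricci tensor is equivalent to $a_1+a_4=0$. 2. If $a_1+a_4=0$, then $L$ is affinely equivalent to any of the pseudo-Riemannian metrics $$\mathbf{A}=\mathcal{C}_1e^{-2\varphi}\left|-a_3\dot t^2+2a_1\dot t\dot r+a_2\dot r^2\right|+\mathcal{C}_2w^2,$$ where $\mathcal{C}_1,\mathcal{C}_2\in\mathbb{R}\setminus\{0\}$ are constants. 3. The canonical connection of $L$ always has $\dim\mathcal{V}(\mathcal{D}_{\mathcal{H}})\leq2$.
   Context: $M\subset\mathbb{R}^4\setminus\{0\}$ is open, with spherical coordinates $(x^a)=(t,r,\theta,\phi)$; $(x^a,\dot x^a)$ are the induced coordinates on $TM$, $\partial_a=\partial/\partial x^a$, $\dot\partial_a=\partial/\partial\dot x^a$, $w^2=\dot\theta^2+\dot\phi^2\sin^2\theta$. A conic subbundle is an open $\mathcal{A}\subset TM\setminus0$ projecting onto $M$ and stable under positive rescaling of vectors. A (pseudo-)Finsler function is a smooth $L:\mathcal{A}\to\mathbb{R}$, positively 2-homogeneous in $\dot x$, with nonsingular Hessian $g_{ab}=\frac12\dot\partial_a\dot\partial_bL$ (any signature). It is (pseudo-)Riemannian if $L=a_{ab}(x)\dot x^a\dot x^b$, and nontrivially Finslerian (non-Riemannian) otherwise. With $G^a=\frac14g^{ab}(\dot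 x^c\partial_c\dot\partial_bL-\partial_bL)$, $L$ is Berwald if $2G^c=\Gamma^c_{ab}(x)\dot x^a\dot x^b$ for a torsion-free affine connection $\nabla$ on $M$ (its canonical connection). Two Berwald metrics are affinely equivalent if they have the same canonical connection (for a pseudo-Riemannian metric this is the Levi-Civita connection). $\delta_a=\partial_a-\Gamma^c_{ab}\dot x^b\dot\partial_c$; $\mathcal{D}_{\mathcal{H}}=\mathrm{Span}\{\delta_a,[\delta_a,\delta_b],[\delta_a,[\delta_b,\delta_c]],\dots\}=\mathrm{Span}\{\delta_a\}\oplus\mathcal{V}(\mathcal{D}_{\mathcal{H}})$ on $\mathcal{A}$, where $\mathcal{V}(\mathcal{D}_{\mathcal{H}})\subset\mathrm{Span}\{\dot\partial_a\}$ is the vertical part; dimension means fibre dimension. Curvature: $[\delta_b,\delta_c]=R^a{}_{bc}\dot\partial_a$, $R_b{}^a{}_{cd}=\dot\partial_bR^a{}_{cd}$; the connection Ricci tensor is $R_{bc}=R_b{}^a{}_{ca}$. $L$ is spatially spherically symmetric if $L=L(t,r,\dot t,\dot r,w)$ (invariance under $SO(3)$ rotations fixing $t$). Its canonical connection has the coefficients, with $k_i=k_i(t,r)$: $\Gamma^t_{tt}=k_1$, $\Gamma^t_{tr}=k_2$, $\Gamma^t_{rr}=k_3$, $\Gamma^r_{tt}=k_4$, $\Gamma^r_{rr}=k_5$, $\Gamma^r_{tr}=k_6$, $\Gamma^t_{\theta\theta}=\Gamma^t_{\phi\phi}/\sin^2\theta=k_7$, $\Gamma^\phi_{\phi t}=\Gamma^\theta_{\theta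 t}=k_8$, $\Gamma^\phi_{\phi r}=\Gamma^\theta_{\theta r}=k_9$, $\Gamma^r_{\theta\theta}=\Gamma^r_{\phi\phi}/\sin^2\theta=k_{10}$, $\Gamma^\theta_{\phi\phi}=-\sin\theta\cos\theta$, $\Gamma^\phi_{\theta\phi}=\cot\theta$, the remaining ones (up to lower-index symmetry) being zero. Curvature functions (commas are partial derivatives): $a_1=k_{1,r}-k_{2,t}+k_3k_4-k_2k_6$, $a_2=k_{2,r}-k_{3,t}+k_2^2+k_3k_6-k_1k_3-k_2k_5$, $a_3=k_{4,r}-k_{6,t}+k_1k_6+k_4k_5-k_2k_4-k_6^2$, $a_4=k_{6,r}-k_{5,t}+k_2k_6-k_3k_4$, $a_5=k_{8,r}-k_{9,t}$; $[\delta_t,\delta_r]=(a_1\dot t+a_2\dot r)\dot\partial_t+(a_3\dot t+a_4\dot r)\dot\partial_r+a_5\dot\theta\,\dot\partial_\theta+a_5\dot\phi\,\dot\partial_\phi$. For non-Riemannian $L$, the brackets $[\delta_t,[\delta_t,\delta_r]]$ and $[\delta_r,[\delta_t,\delta_r]]$ are proportional to $[\delta_t,\delta_r]$. Class 5: non-Riemannian spatially spherically symmetric Berwald metrics whose canonical connection satisfies $k_7=k_8=k_9=k_{10}=0$ and $[\delta_t,\delta_r]\neq0$. Then $a_1a_4-a_2a_3\neq0$ and $$L=w^2\xi(q),\quad q=\frac{\dot t\,e^{I(t,r,p)-\varphi}}{w},\quad p=\frac{\dot r}{\dot t},\quad I=\int\frac{a_1+a_2p}{a_2p^2+(a_1-a_4)p-a_3}\,dp,$$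 where $\xi$ is a function of a single variable and $\varphi=\varphi(t,r)$ is the function of $(t,r)$ occurring in this representation, determined up to an additive constant (once the primitive $I$ is chosen) by the Berwald conditions $\delta_tq=\delta_rq=0$. When $a_1+a_4=0$, the primitive is taken to be $I=\frac12\ln\left|-a_3+2a_1p+a_2p^2\right|$, and $\varphi$ in part 2 is the function corresponding to this choice. *)

(* Defs.v *)
From HB Require Import structures.
From mathcomp Require Import all_boot all_order all_algebra.
From mathcomp Require Import all_classical all_reals all_analysis.

Set Implicit Arguments.
Unset Strict Implicit.
Unset Printing Implicit Defensive.

Import Order.TTheory GRing.Theory Num.Theory.
Import numFieldNormedType.Exports.

Local Open Scope classical_set_scope.
Local Open Scope ring_scope.

(* C^n on an open set U; in finite dimension this agrees with the definition by
   continuous partial derivatives. *)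
Fixpoint Cn (R : realType) (V W : normedModType R) (n : nat) (U : set V)
    (f : V -> W) : Prop :=
  match n with
  | 0%N => forall x, U x -> {for x, continuous f}
  | m.+1 => (forall x, U x -> differentiable f x) /\
            (forall v : V, Cn m U (fun x => 'D_v f x))
  end.

Definition smooth (R : realType) (V W : normedModType R) (U : set V)
    (f : V -> W) : Prop := forall n, Cn n U f.

(* The coordinates (x^a) = (t, r, theta, phi) have indices 0, 1, 2, 3. *)
Notation vec R := 'rV[R]_4.

(* A point (x, xdot) of TM; also used for the components of a tangent vector of
   TM in the frame (partial_a, dot partial_a). *)
Notation tpt R := ('rV[R]_4 * 'rV[R]_4)%type.

Definition it : 'I_4 := @Ordinal 4 0 isT.
Definition ir : 'I_4 := @Ordinal 4 1 isT.
Definition ith : 'I_4 := @Ordinal 4 2 isT.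
Definition iph : 'I_4 := @Ordinal 4 3 isT.

Section Finsler.
Variable R : realType.
Implicit Types (M : set (vec R)) (A : set (tpt R)) (L : tpt R -> R) (u : tpt R).

(* Domain of the spherical coordinates; the azimuth is not restricted to one
   period. *)
Definition sph_chart : set (vec R) :=
  [set x | 0 < x 0 ir /\ 0 < x 0 ith < pi].

(* Functions on subsets of TM are total functions; only their values on the
   relevant open subset matter. *)
Definition dx (a : 'I_4) (f : tpt R -> R) u : R := 'D_(delta_mx 0 a, 0) f u.
Definition dy (a : 'I_4) (f : tpt R -> R) u : R := 'D_(0, delta_mx 0 a) f u.

Definition slit M : set (tpt R) := [set u | M u.1 /\ u.2 != 0].

Definition conic_subbundle M A : Prop :=
  [/\ open A,
      A `<=` slit M,
      (forall x, M x -> exists y, A (x, y)) &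
      (forall x y (c : R), 0 < c -> A (x, y) -> A (x, c *: y))].

Definition fundamental_tensor L u : 'M[R]_4 :=
  \matrix_(a, b) (2^-1 * dy a (dy b L) u).

Definition finsler M A L : Prop :=
  [/\ conic_subbundle M A,
      smooth A L,
      (forall x y (c : R), 0 < c -> A (x, y) -> L (x, c *: y) = c ^+ 2 * L (x, y)) &
      (forall u, A u -> fundamental_tensor L u \in unitmx)].

Definition quadratic_on A L : Prop :=
  exists a : vec R -> 'M[R]_4, forall u, A u ->
    L u = \sum_(i < 4) \sum_(j < 4) a u.1 i j * u.2 0 i * u.2 0 j.

Definition pseudo_riemannian M A L : Prop := finsler M A L /\ quadratic_on A L.

Definition geodesic_spray L u (a : 'I_4) : R :=
  4^-1 * \sum_(b < 4) invmx (fundamental_tensor L u) a b *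
    (\sum_(c < 4) u.2 0 c * dx c (dy b L) u - dx b L u).

(* G x c a b stands for Gamma^c_{ab}(x). *)
Definition coefs := vec R -> 'I_4 -> 'I_4 -> 'I_4 -> R.
Implicit Types (G : coefs).

Definition torsion_free_connection M G : Prop :=
  (forall c a b, smooth M (fun x => G x c a b)) /\
  (forall x c a b, M x -> G x c a b = G x c b a).

Definition canonical_connection M A L G : Prop :=
  torsion_free_connection M G /\
  (forall u c, A u -> 2 * geodesic_spray L u c =
     \sum_(a < 4) \sum_(b < 4) G u.1 c a b * u.2 0 a * u.2 0 b).

Definition affinely_equivalent M A1 L1 A2 L2 : Prop :=
  [/\ finsler M A1 L1, finsler M A2 L2 &
      exists G, canonical_connection M A1 L1 G /\ canonical_connection M A2 L2 G].

Definition lie (X Y : tpt R -> tpt R) (u : tpt R) : tpt R :=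
  'D_(X u) Y u - 'D_(Y u) X u.

Definition delta G (a : 'I_4) (u : tpt R) : tpt R :=
  (delta_mx 0 a, - \row_c (\sum_(b < 4) G u.1 c a b * u.2 0 b)).

(* curv G a b c is R^a_{bc}. *)
Definition curv G (a b c : 'I_4) (u : tpt R) : R :=
  (lie (delta G b) (delta G c) u).2 0 a.

(* R_{bc} = R_b^a_{ca}, where R_b^a_{cd} = dy b R^a_{cd}. *)
Definition ricci G (b c : 'I_4) (u : tpt R) : R :=
  \sum_(a < 4) dy b (curv G a c a) u.

Inductive hbracket G : (tpt R -> tpt R) -> Prop :=
| hbracket_delta a : hbracket G (delta G a)
| hbracket_lie a X : hbracket G X -> hbracket G (lie (delta G a) X).

Definition hdistr G u : set (tpt R) :=
  [set v | exists s : seq (tpt R),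
     (forall z, z \in s -> exists X, hbracket G X /\ z = X u) /\ v \in span s].

(* Fibre of the vertical part; a vertical vector is given by its
   dot partial_a components. *)
Definition vertical_part G u : set (vec R) := [set v | hdistr G u (0, v)].

Definition dim_le (S : set (vec R)) (n : nat) : Prop :=
  exists W : {vspace (vec R)}, (forall v, S v <-> v \in W) /\ (\dim W <= n)%N.

Definition wfun u : R :=
  Num.sqrt (u.2 0 ith ^+ 2 + u.2 0 iph ^+ 2 * sin (u.1 0 ith) ^+ 2).

Definition spherically_symmetric A L : Prop :=
  exists F : R -> R -> R -> R -> R -> R, forall u, A u ->
    L u = F (u.1 0 it) (u.1 0 ir) (u.2 0 it) (u.2 0 ir) (wfun u).

(* Functions of (t, r), in this order. *)
Record sphcoef := SphCoef {
  k1 : R -> R -> R; k2 : R -> R -> R; k3 : R -> R -> R; k4 : R -> R -> R;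
  k5 : R -> R -> R; k6 : R -> R -> R; k7 : R -> R -> R; k8 : R -> R -> R;
  k9 : R -> R -> R; k10 : R -> R -> R }.

Implicit Types (K : sphcoef).

Definition sphG K : coefs := fun x c a b =>
  let t := x 0 it in let r := x 0 ir in let th := x 0 ith in
  match nat_of_ord c, nat_of_ord a, nat_of_ord b with
  | 0, 0, 0 => k1 K t r
  | 0, 0, 1 | 0, 1, 0 => k2 K t r
  | 0, 1, 1 => k3 K t r
  | 1, 0, 0 => k4 K t r
  | 1, 1, 1 => k5 K t r
  | 1, 0, 1 | 1, 1, 0 => k6 K t r
  | 0, 2, 2 => k7 K t r
  | 0, 3, 3 => (k7 K t r * sin th ^+ 2)%R
  | 2, 2, 0 | 2, 0, 2 | 3, 3, 0 | 3, 0, 3 => k8 K t r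
  | 2, 2, 1 | 2, 1, 2 | 3, 3, 1 | 3, 1, 3 => k9 K t r
  | 1, 2, 2 => k10 K t r
  | 1, 3, 3 => (k10 K t r * sin th ^+ 2)%R
  | 2, 3, 3 => (- (sin th * cos th))%R
  | 3, 2, 3 | 3, 3, 2 => (cos th / sin th)%R
  | _, _, _ => 0%R
  end%N.

Definition pt (f : R -> R -> R) (t r : R) : R := derive1 (fun s => f s r) t.
Definition pr (f : R -> R -> R) (t r : R) : R := derive1 (fun s => f t s) r.

Definition a1 K t r := pr (k1 K) t r - pt (k2 K) t r
  + k3 K t r * k4 K t r - k2 K t r * k6 K t r.
Definition a2 K t r := pr (k2 K) t r - pt (k3 K) t r + k2 K t r ^+ 2
  + k3 K t r * k6 K t r - k1 K t r * k3 K t r - k2 K t r * k5 K t r.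
Definition a3 K t r := pr (k4 K) t r - pt (k6 K) t r + k1 K t r * k6 K t r
  + k4 K t r * k5 K t r - k2 K t r * k4 K t r - k6 K t r ^+ 2.
Definition a4 K t r := pr (k6 K) t r - pt (k5 K) t r
  + k2 K t r * k6 K t r - k3 K t r * k4 K t r.
Definition a5 K t r := pr (k8 K) t r - pt (k9 K) t r.

(* [delta_t, delta_r] <> 0 is read pointwise on M: over each x in M it is not
   the zero vector field on the fibre of A. (Being linear in the fibre
   variables, it may vanish at particular vectors.) *)
Record class5 M A L K : Prop := {
  class5_open : open M;
  class5_chart : M `<=` sph_chart;
  class5_finsler : finsler M A L;
  class5_nontrivial : ~ quadratic_on A L;
  class5_sym : spherically_symmetric A L;
  class5_conn : canonical_connection M A L (sphG K);
  class5_k : forall x, M x -> let t := x 0 it in let r := x 0 ir in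
    [/\ k7 K t r = 0, k8 K t r = 0, k9 K t r = 0 & k10 K t r = 0];
  class5_curv : forall x, M x -> exists y, A (x, y) /\
    lie (delta (sphG K) it) (delta (sphG K) ir) (x, y) <> 0 }.

Definition Ifun K (t r p : R) : R :=
  2^-1 * ln `| - a3 K t r + 2 * a1 K t r * p + a2 K t r * p ^+ 2 |.

Definition qfun K (vphi : R -> R -> R) u : R :=
  let t := u.1 0 it in let r := u.1 0 ir in
  u.2 0 it * expR (Ifun K t r (u.2 0 ir / u.2 0 it) - vphi t r) / wfun u.

Definition Qform K u : R :=
  let t := u.1 0 it in let r := u.1 0 ir in
  - a3 K t r * u.2 0 it ^+ 2 + 2 * a1 K t r * u.2 0 it * u.2 0 ir
  + a2 K t r * u.2 0 ir ^+ 2.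

(* vphi occurs in the representation L = w^2 xi(q) with the above choice of the
   primitive I, when a1 + a4 = 0. The formula for q makes sense where tdot, w
   and -a3 + 2 a1 p + a2 p^2 do not vanish. As the latter changes sign on A in
   general, while q only sees its absolute value, the function xi is local. *)
Definition class5_phi A L M K (vphi : R -> R -> R) : Prop :=
  smooth M (fun x : vec R => vphi (x 0 it) (x 0 ir)) /\
  forall u, A u -> u.2 0 it != 0 -> wfun u != 0 -> Qform K u != 0 ->
    [/\ 'D_(delta (sphG K) it u) (qfun K vphi) u = 0,
        'D_(delta (sphG K) ir u) (qfun K vphi) u = 0 &
        exists xi : R -> R, \forall v \near u, L v = wfun v ^+ 2 * xi (qfun K vphi v)].

(* |Q| is smooth, and quadratic up to sign, where Q does not vanish. *)
Definition Adom M K : set (tpt R) := [set u | M u.1 /\ Qform K u != 0].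

Definition Ametric K (vphi : R -> R -> R) (C1 C2 : R) u : R :=
  C1 * expR (- 2 * vphi (u.1 0 it) (u.1 0 ir)) * `| Qform K u | + C2 * wfun u ^+ 2.

End Finsler.

(* Main.v *)
(* A Berwald function L is annihilated by the horizontal fields delta_a, hence by
   all their iterated brackets, which are vertical fields linear in xdot. Since
   k7 = k8 = k9 = k10 = 0, the connection is the product of a connection in
   (t, r) and that of the round sphere, so that a bracket is a 2x2 block acting
   on (tdot, rdot) plus a multiple of the rotation [delta_theta, delta_phi].
   Let B be the block of [delta_t, delta_r] and C that of another bracket. If B
   were singular, or if B y and C y were independent for some y, then L would be
   constant in a fixed direction on an open subset of a fibre and its Hessian
   would be singular. Hence det B <> 0 and C y is a multiple of B y, which bounds
   the dimension of the vertical part.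
   For part 2, q^2 w^2 = e^(-2 phi) |Q| with Q quadratic, so delta_a q = 0 says
   that the quadratic form delta_a (e^(-2 phi) Q) vanishes on an open subset of
   each fibre, thus identically. So delta_a annihilates the metric, and this is
   equivalent to having the given canonical connection. *)

Require Import Defs.
From mathcomp Require Import all_boot all_order all_algebra.
From mathcomp Require Import all_classical all_reals all_analysis.
From mathcomp Require Import ring lra.
Import Order.TTheory GRing.Theory Num.Theory.
Import numFieldNormedType.Exports.
Local Open Scope classical_set_scope.
Local Open Scope ring_scope.

Set Implicit Arguments.
Unset Strict Implicit.
Unset Printing Implicit Defensive.

(** * Directional derivatives and smooth functions *)

(** The canonical connection is defined through the spray, which contains the inverse Hessian, while
    the argument needs the first-order equations delta_a L = 0. The two are related by contracting
    with xdot and differentiating along the fibre; this, and the passage to brackets, rests on the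
    symmetry of second derivatives. A fibre of the conic subbundle is only an open set and may miss
    any given direction. Genericity conditions are therefore written as the nonvanishing of
    quadratic forms in xdot: by the parallelogram identity, a form that is zero on a nonempty open
    set is zero everywhere. |Q| is not smooth on the null cone of Q. For s = 1 and s = -1, the
    metric with s Q in place of |Q| is quadratic on all nonzero vectors, and near any vector with Q
    nonzero [Ametric] agrees with one of the two. *)

Section DirectionalDerivatives.
Variable R : realType.

Lemma near_open (V : normedModType R) (U : set V) (x : V) (P : V -> Prop) :
  open U -> U x -> (forall y, U y -> P y) -> \forall y \near x, P y.
Proof.
move=> oU Ux UP; have Unbhs : nbhs x U by exact: open_nbhs_nbhs.
exact: filterS Unbhs.
Qed.

Lemma eq_derive_open (V W : normedModType R) (U : set V) (f g : V -> W) v x :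
  open U -> U x -> (forall y, U y -> f y = g y) -> 'D_v f x = 'D_v g x.
Proof.
by move=> oU Ux fg; apply: near_eq_derive; exact: near_open oU Ux _.
Qed.

Lemma eq_is_derive_open (V W : normedModType R) (U : set V) (f g : V -> W) v x d :
  open U -> U x -> (forall y, U y -> f y = g y) ->
  is_derive x v f d -> is_derive x v g d.
Proof.
by move=> oU Ux fg; apply: near_eq_is_derive; exact: near_open oU Ux _.
Qed.

(** The first-order expansion of [f] at [x] involves only points near [x], so it also holds for [g];
    uniqueness of the differential concludes. *)
Lemma eq_differentiable_open (V W : normedModType R) (U : set V) (f g : V -> W) x :
  open U -> U x -> (forall y, U y -> f y = g y) ->
  differentiable f x -> differentiable g x.
Proof.
move=> oU Ux fg /diff_locallyP [cf /eqaddoP Hf].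
have Hg : g \o shift x = cst (g x) + 'd f x +o_ 0 id.
  apply/eqaddoP => e e0; have := Hf e e0.
  have : \forall h \near (0 : V), U (h + x).
    rewrite (near_shift x) sub0r; apply: near_open oU Ux _ => y Uy /=.
    by rewrite subrK.
  apply: filterS2 => h /= Uh.
  by rewrite -![(_ - _ : _ -> _) h]/(_ - _) -![(_ + _ : _ -> _) h]/(_ + _) /= /cst !fg.
have dg : 'd g x = 'd f x :> (V -> W) by exact: diff_unique.
by apply/diff_locallyP; rewrite dg.
Qed.

Lemma diff_is_derive (V W : normedModType R) (f : V -> W) x v :
  differentiable f x -> is_derive x v f ('D_v f x).
Proof. by move=> df; apply/derivableP/diff_derivable. Qed.

Lemma is_deriveE (V W : normedModType R) (f : V -> W) x v d :
  is_derive x v f d -> 'D_v f x = d.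
Proof. by case. Qed.

Lemma is_derive_line (V W : normedModType R) (f : V -> W) (x v : V) (s : R) d :
  is_derive (x + s *: v) v f d -> is_derive s (1 : R) (fun h => f (x + h *: v)) d.
Proof.
have e : (fun h : R => h^-1 *: (((fun h => f (x + h *: v)) \o shift s) (h *: 1) - f (x + s *: v)))
   = (fun h : R => h^-1 *: ((f \o shift (x + s *: v)) (h *: v) - f (x + s *: v))).
  rewrite funeqE => h /=; congr (_ *: (f _ - _)).
  by rewrite [h *: 1]mulr1 scalerDl addrCA.
by case=> df vf; split; [rewrite /derivable e|rewrite /derive e].
Qed.

Lemma deriveDdir (V W : normedModType R) (f : V -> W) x v w :
  differentiable f x -> 'D_(v + w) f x = 'D_v f x + 'D_w f x.
Proof. by move=> df; rewrite !deriveE // linearD. Qed.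

Lemma deriveZdir (V W : normedModType R) (f : V -> W) x c v :
  differentiable f x -> 'D_(c *: v) f x = c *: 'D_v f x.
Proof. by move=> df; rewrite !deriveE // linearZ. Qed.

Lemma derive_sumdir (V W : normedModType R) (f : V -> W) x n (v : 'I_n -> V) :
  differentiable f x -> 'D_(\sum_i v i) f x = \sum_i 'D_(v i) f x.
Proof.
by move=> df; rewrite deriveE // linear_sum; apply: eq_bigr => i _; rewrite deriveE.
Qed.

Lemma is_derive_lam_add (V : normedModType R) (f g : V -> R) x v a b :
  is_derive x v f a -> is_derive x v g b ->
  is_derive x v (fun y => f y + g y) (a + b).
Proof. exact: is_deriveD. Qed.

Lemma is_derive_lam_opp (V : normedModType R) (f : V -> R) x v a :
  is_derive x v f a -> is_derive x v (fun y => - f y) (- a).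
Proof. exact: is_deriveN. Qed.

Lemma is_derive_lam_mul (V : normedModType R) (f g : V -> R) x v a b :
  is_derive x v f a -> is_derive x v g b ->
  is_derive x v (fun y => f y * g y) (a * g x + f x * b).
Proof.
move=> fa gb; apply: is_derive_eq (is_deriveM fa gb) _.
by rewrite addrC [_ *: _]mulrC.
Qed.

Lemma is_derive_lam_sum (V : normedModType R) n (f : 'I_n -> V -> R) x v a :
  (forall i, is_derive x v (f i) (a i)) ->
  is_derive x v (fun y => \sum_i f i y) (\sum_i a i).
Proof.
move=> fa; rewrite (_ : (fun y => _) = \sum_i f i); first exact: is_derive_sum.
by rewrite funeqE => y; rewrite fct_sumE.
Qed.

Lemma is_derive_lam_cst (V W : normedModType R) (c : W) (x v : V) :
  is_derive x v (fun=> c) 0.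
Proof. exact: is_derive_cst. Qed.

(** Only derivability of [f] along [v] is assumed: restricted to the line [s *: v + x], the claim is
    the chain rule in one variable. *)
Lemma is_derive_chain (V : normedModType R) (h : R -> R) (f : V -> R) x v a b :
  is_derive (f x) 1 h b -> is_derive x v f a ->
  is_derive x v (fun y => h (f y)) (b * a).
Proof.
have E (F : V -> R) d : is_derive x v F d <->
    is_derive (0 : R) (1 : R) (fun s => F (s *: v + x)) d.
  have e : (fun k : R => k^-1 *: (((fun s => F (s *: v + x)) \o shift 0) (k *: 1)
      - F (0 *: v + x))) = (fun k : R => k^-1 *: ((F \o shift x) (k *: v) - F x)).
    rewrite funeqE => k /=; congr (_ *: (F _ - F _)); last by rewrite scale0r add0r.
    by rewrite addr0 [k *: 1]mulr1.
  by split=> -[dF vF]; split; move: dF vF; rewrite /derivable /derive e.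
move=> [/derivable1_diffP dh vh] /E [/derivable1_diffP df vf]; apply/E.
have dh' : differentiable h ((fun s : R => f (s *: v + x)) 0).
  by rewrite /= scale0r add0r.
have dc := differentiable_comp df dh'.
apply: DeriveDef; first exact: diff_derivable.
rewrite deriveE // (_ : (fun s => _) = h \o (fun s : R => f (s *: v + x))) //.
rewrite diff_comp //=; set u := ('d _ _ _ in X in 'd h _ X).
have -> : u = a by rewrite /u -deriveE.
rewrite -[a in LHS]mulr1 [LHS]linearZ /= scale0r add0r -deriveE //.
by rewrite vh mulrC.
Qed.

End DirectionalDerivatives.

(** * Closure properties of smooth functions *)

Section SmoothFunctions.
Variable R : realType.
Implicit Types V W : normedModType R.

Lemma is_derive_linear V W (f : V -> W) (x v : V) :
  (forall (h : R) y z, f (h *: y + z) = h *: f y + f z) -> is_derive x v f (f v).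
Proof.
move=> fl; have c : (fun h : R => h^-1 *: ((f \o shift x) (h *: v) - f x)) @ 0^' --> f v.
  apply: cvg_near_cst; near=> h.
  rewrite /= fl addrK scalerA mulVf ?scale1r //.
  by near: h; exact: nbhs_dnbhs_neq.
by split; [apply/cvg_ex; exists (f v)|exact: cvg_lim].
Unshelve. all: by end_near. Qed.

Lemma smooth_differentiable V W (U : set V) (f : V -> W) x :
  smooth U f -> U x -> differentiable f x.
Proof. by move=> /(_ 1%N) [+ _]; exact. Qed.

Lemma smooth_derive V W (U : set V) (f : V -> W) v :
  smooth U f -> smooth U (fun x => 'D_v f x).
Proof. by move=> fs n; have [_] := fs n.+1; exact. Qed.

Lemma CnW V W n (U : set V) (f : V -> W) : Cn n.+1 U f -> Cn n U f.
Proof.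
elim: n f => [|n IHn] f [df Df].
  by move=> x Ux; apply: differentiable_continuous; exact: df.
by split=> // v; apply: IHn; exact: Df.
Qed.

Lemma eq_Cn V W n (U : set V) (f g : V -> W) :
  open U -> (forall x, U x -> f x = g x) -> Cn n U f -> Cn n U g.
Proof.
move=> oU; elim: n f g => [|n IHn] f g fg.
  move=> cf x Ux; rewrite /prop_for /continuous_at -fg //.
  apply: cvg_trans (cf x Ux); apply: near_eq_cvg.
  exact: near_open oU Ux _.
move=> [df Df]; split=> [x Ux|v].
  exact: eq_differentiable_open oU Ux fg (df x Ux).
apply: IHn (Df v) => x Ux; exact: eq_derive_open oU Ux fg.
Qed.

Lemma subset_Cn V W n (U U' : set V) (f : V -> W) :
  U' `<=` U -> Cn n U f -> Cn n U' f.
Proof.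
move=> sU; elim: n f => [|n IHn] f; first by move=> cf x /sU; exact: cf.
by move=> [df Df]; split=> [x /sU|v]; [exact: df|exact: IHn (Df v)].
Qed.

Lemma Cn_setU V W n (U U' : set V) (f : V -> W) :
  Cn n U f -> Cn n U' f -> Cn n (U `|` U') f.
Proof.
elim: n f => [|n IHn] f.
  by move=> cf cf' x [Ux|Ux]; [exact: cf|exact: cf'].
move=> [df Df] [df' Df']; split=> [x [Ux|Ux]|v]; [exact: df|exact: df'|exact: IHn (Df v) (Df' v)].
Qed.

Lemma Cn_cst V W n (U : set V) (c : W) : Cn n U (fun=> c).
Proof.
elim: n c => [|n IHn] c; first by move=> x _; exact: cst_continuous.
split=> [x _|v]; first exact: differentiable_cst.
suff -> : (fun x => 'D_v (fun=> c : W) x) = (fun=> 0) by exact: IHn.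
by rewrite funeqE => x; exact: derive_cst.
Qed.

Lemma Cn_linear V W n (U : set V) (f : V -> W) :
  (forall x, differentiable f x) ->
  (forall (h : R) y z, f (h *: y + z) = h *: f y + f z) -> Cn n U f.
Proof.
move=> df fl; case: n => [|n].
  by move=> x _; exact: differentiable_continuous.
split=> [x _|v]; first exact: df.
suff -> : (fun x => 'D_v f x) = (fun=> f v) by exact: Cn_cst.
rewrite funeqE => x; have dfl := is_derive_linear x v fl.
by rewrite derive_val.
Qed.

Lemma CnD V n (U : set V) (f g : V -> R) : open U ->
  Cn n U f -> Cn n U g -> Cn n U (fun x => f x + g x).
Proof.
move=> oU; elim: n f g => [|n IHn] f g.
  by move=> cf cg x Ux; apply: continuousD; [exact: cf|exact: cg].
move=> [df Df] [dg Dg]; split=> [x Ux|v].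
  by apply: (@differentiableD _ _ _ f g); [exact: df|exact: dg].
apply: (eq_Cn oU) (IHn _ _ (Df v) (Dg v)) => x Ux.
have dfx := diff_is_derive v (df x Ux); have dgx := diff_is_derive v (dg x Ux).
by have dfg := is_derive_lam_add dfx dgx; rewrite [RHS]derive_val.
Qed.

Lemma CnM V n (U : set V) (f g : V -> R) : open U ->
  Cn n U f -> Cn n U g -> Cn n U (fun x => f x * g x).
Proof.
move=> oU; elim: n f g => [|n IHn] f g.
  by move=> cf cg x Ux; apply: continuousM; [exact: cf|exact: cg].
move=> Cf Cg; have [df Df] := Cf; have [dg Dg] := Cg; split=> [x Ux|v].
  by apply: (@differentiableM _ _ f g); [exact: df|exact: dg].
have C := CnD oU (IHn _ _ (Df v) (CnW Cg)) (IHn _ _ (CnW Cf) (Dg v)).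
apply: (eq_Cn oU) C => x Ux.
have dfx := diff_is_derive v (df x Ux); have dgx := diff_is_derive v (dg x Ux).
by have dfg := is_derive_lam_mul dfx dgx; rewrite [RHS]derive_val.
Qed.

Lemma CnN V n (U : set V) (f : V -> R) : open U ->
  Cn n U f -> Cn n U (fun x => - f x).
Proof.
move=> oU Cf; have := CnM oU (Cn_cst n U (-1 : R)) Cf.
by rewrite (_ : (fun x => _) = fun x => - f x) // funeqE => x; rewrite mulN1r.
Qed.

Lemma Cn_sum V n (U : set V) m (f : 'I_m -> V -> R) : open U ->
  (forall i, Cn n U (f i)) -> Cn n U (fun x => \sum_i f i x).
Proof.
move=> oU; elim: m f => [|m IHm] f Cf.
  rewrite (_ : (fun x => _) = fun=> 0); first exact: Cn_cst.
  by rewrite funeqE => x; rewrite big_ord0.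
rewrite (_ : (fun x => _) = fun x => f ord0 x + \sum_i f (lift ord0 i) x).
  by apply: CnD => //; exact: IHm.
by rewrite funeqE => x; rewrite big_ord_recl.
Qed.

Lemma diff_chain V (h : R -> R) (f : V -> R) x :
  derivable h (f x) 1 -> differentiable f x -> differentiable (fun y => h (f y)) x.
Proof. by move=> /derivable1_diffP dh df; exact: (@differentiable_comp _ _ _ _ f h). Qed.

Lemma Cn_expR V n (U : set V) (f : V -> R) : open U ->
  Cn n U f -> Cn n U (fun x => expR (f x)).
Proof.
move=> oU; elim: n f => [|n IHn] f.
  by move=> cf x Ux; apply: (continuous_comp (cf x Ux)); exact: continuous_expR.
move=> Cf; have [df Df] := Cf; split=> [x Ux|v].
  by apply: diff_chain; [exact: derivable_expR|exact: df].
apply: (eq_Cn oU) (CnM oU (IHn _ (CnW Cf)) (Df v)) => x Ux.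
have dfx := diff_is_derive v (df x Ux).
have de := is_derive_chain (is_derive_expR (f x)) dfx.
by rewrite [RHS]derive_val.
Qed.

(** Proved jointly, since the derivative of each function involves the other. *)
Lemma Cn_sin_cos V n (U : set V) (f : V -> R) : open U -> Cn n U f ->
  Cn n U (fun x => sin (f x)) /\ Cn n U (fun x => cos (f x)).
Proof.
move=> oU; elim: n f => [|n IHn] f.
  move=> cf; split=> x Ux; apply: (continuous_comp (cf x Ux)).
    exact: continuous_sin.
  exact: continuous_cos.
move=> Cf; have [df Df] := Cf; have [Cs Cc] := IHn _ (CnW Cf).
split; (split=> [x Ux|v]; first by apply: diff_chain => //; exact: df).
  apply: (eq_Cn oU) (CnM oU Cc (Df v)) => x Ux.
  have dfx := diff_is_derive v (df x Ux).
  have de := is_derive_chain (is_derive_sin (f x)) dfx.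
  by rewrite [RHS]derive_val.
apply: (eq_Cn oU) (CnM oU (CnN oU Cs) (Df v)) => x Ux.
have dfx := diff_is_derive v (df x Ux).
have de := is_derive_chain (is_derive_cos (f x)) dfx.
by rewrite [RHS]derive_val.
Qed.

Lemma differentiable_fst V1 V2 (u : V1 * V2) : differentiable (fst : V1 * V2 -> V1) u.
Proof.
have H := @linear_differentiable R (V1 * V2)%type V1
  (fst : {linear (V1 * V2)%type -> V1}) u.
by apply: H => w; exact: cvg_fst.
Qed.

Lemma differentiable_snd V1 V2 (u : V1 * V2) : differentiable (snd : V1 * V2 -> V2) u.
Proof.
have H := @linear_differentiable R (V1 * V2)%type V2
  (snd : {linear (V1 * V2)%type -> V2}) u.
by apply: H => w; exact: cvg_snd.
Qed.

Lemma is_derive_fst (V1 V2 W : normedModType R) (f : V1 -> W) (v u : V1 * V2) d :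
  is_derive u.1 v.1 f d -> is_derive u v (fun w : V1 * V2 => f w.1) d.
Proof. by case=> df vf; split. Qed.

Lemma Cn_fst (V1 V2 W : normedModType R) n (U : set V1) (f : V1 -> W) :
  Cn n U f -> Cn n [set u : V1 * V2 | U u.1] (fun u => f u.1).
Proof.
elim: n f => [|n IHn] f.
  move=> cf u Uu; apply: (continuous_comp (@cvg_fst _ _ _ _ _)); exact: cf.
move=> [df Df]; split=> [u Uu|v].
  apply: (@differentiable_comp _ _ _ _ (fst : V1 * V2 -> V1) f); last exact: df.
  exact: differentiable_fst.
exact: IHn (Df v.1).
Qed.

Lemma open_over (U : set (vec R)) : open U -> open [set u : tpt R | U u.1].
Proof.
rewrite openE => oU; rewrite openE => u Uu.
exact: (@cvg_fst _ _ (nbhs u.1) (nbhs u.2) _ _ (oU _ Uu)).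
Qed.

End SmoothFunctions.

(** * Symmetry of second derivatives *)

Section MixedDerivatives.
Variables (R : realType) (V : normedModType R).
Implicit Types (f : V -> R) (U : set V).

Lemma mean_value_line f (x v : V) (h : R) : 0 < h ->
  (forall s, 0 <= s <= h -> differentiable f (x + s *: v)) ->
  exists2 s, 0 < s < h & f (x + h *: v) - f x = h * 'D_v f (x + s *: v).
Proof.
move=> h0 df; pose g s := f (x + s *: v).
have dg s : 0 <= s <= h -> is_derive s (1 : R) g ('D_v f (x + s *: v)).
  by move=> /df ds; apply: is_derive_line; exact: diff_is_derive.
have [||s s0] := @MVT R g (fun s => 'D_v f (x + s *: v)) 0 h h0.
- by move=> s; rewrite in_itv /= => /andP[s0 s1]; apply: dg; rewrite !ltW.
- apply: derivable_within_continuous => s; rewrite in_itv /= => s0.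
  by have := dg _ s0; case.
- rewrite /g scale0r addr0 subr0 => E; exists s; last by rewrite E mulrC.
  by move: s0; rewrite in_itv.
Qed.

(** The mean value theorem is applied twice: to the increment of [f] along [h *: w], in the
    direction [v], and then to ['D_v f] in the direction [w]. *)
Lemma second_difference U f (x v w : V) (h : R) : 0 < h -> smooth U f ->
  (forall s t, 0 <= s <= h -> 0 <= t <= h -> U (x + s *: v + t *: w)) ->
  exists s t, [/\ 0 < s < h, 0 < t < h &
    f (x + h *: v + h *: w) - f (x + h *: v) - (f (x + h *: w) - f x)
      = h * (h * 'D_w ('D_v f) (x + s *: v + t *: w))].
Proof.
move=> h0 fs Ush; have hh : 0 <= h <= h by apply/andP; split=> //; exact: ltW.
have h00 : 0 <= (0 : R) <= h by apply/andP; split=> //; exact: ltW.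
have U0 s : 0 <= s <= h -> U (x + s *: v).
  by move=> s0; have := Ush s 0 s0 h00; rewrite scale0r addr0.
pose g y := f (h *: w + y) - f y.
have dgx y : U y -> U (h *: w + y) ->
    differentiable g y /\ 'D_v g y = 'D_v f (h *: w + y) - 'D_v f y.
  move=> Uy Uhy; have dfy := smooth_differentiable fs Uy.
  have dfh := smooth_differentiable fs Uhy.
  have d1 : differentiable (fun z => f (h *: w + z)) y.
    have ds : differentiable (fun z => h *: w + z) y.
      have := @differentiableD R V V (cst (h *: w)) id y.
      by apply; [exact: differentiable_cst|exact: ex_diff].
    exact: (@differentiable_comp _ _ _ _ (fun z => h *: w + z) f y ds dfh).
  have e1 : 'D_v (fun z => f (h *: w + z)) y = 'D_v f (h *: w + y).
    rewrite /derive; set p := fun k : R => _; set q := fun k : R => _.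
    by suff -> : p = q by []; rewrite funeqE => k; rewrite /p /q /= addrCA.
  split; first exact: (@differentiableB _ _ _ (fun z => f (h *: w + z)) f).
  have i1 := diff_is_derive v d1; have i2 := diff_is_derive v dfy.
  by have i3 := is_derive_lam_add i1 (is_derive_lam_opp i2); rewrite derive_val e1.
have Uw s : 0 <= s <= h -> U (h *: w + (x + s *: v)).
  by move=> s0; rewrite addrC; exact: Ush.
have [s s0|s s0 Es] := @mean_value_line g x v h h0.
  by have [] := dgx _ (U0 _ s0) (Uw _ s0).
have s0' : 0 <= s <= h by case/andP: s0 => /ltW -> /ltW ->.
have [_ Dg] := dgx _ (U0 _ s0') (Uw _ s0').
have [t t0|t t0 Et] := @mean_value_line ('D_v f) (x + s *: v) w h h0.
  exact: smooth_differentiable (smooth_derive v fs) (Ush _ _ s0' t0).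
exists s, t; split=> //; rewrite -Et.
move: Es; rewrite /g Dg ![h *: w + _]addrC => <-; ring.
Qed.

(** On a ball where [F] and [G] each stay within half the distance between [F x] and [G x], no value
    of one equals a value of the other. *)
Lemma continuous_separated U (F G : V -> R) x : open U -> U x ->
  {for x, continuous F} -> {for x, continuous G} -> F x != G x ->
  exists2 d : R, 0 < d & forall y z, ball x d y -> ball x d z -> U y /\ F y != G z.
Proof.
move=> oU Ux cF cG ne.
have e0 : 0 < `|F x - G x| / 2 by rewrite divr_gt0 // normr_gt0 subr_eq0.
have /cvgrPdist_lt/(_ _ e0) nF := cF.
have /cvgrPdist_lt/(_ _ e0) nG := cG.
have nU : \forall y \near x, U y by exact: near_open oU Ux _.
have : \forall y \near x, [/\ U y, `|F x - F y| < `|F x - G x| / 2 &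
  `|G x - G y| < `|F x - G x| / 2] by exact: filterS3 nU nF nG.
move=> /nbhs_ballP[d /= d0 Hd]; exists d => // y z /Hd[Uy Fy _] /Hd[_ _ Gz].
split=> //; apply/negP => /eqP E; rewrite -E distrC in Gz.
have := ler_normD (F x - F y) (F y - G x).
rewrite addrA subrK => /le_lt_trans /(_ (ltrD Fy Gz)).
by rewrite -splitr ltxx.
Qed.

Lemma square_differences_eq f (F G : V -> R) (x v w : V) (h s t s' t' : R) :
  h != 0 ->
  f (x + h *: v + h *: w) - f (x + h *: v) - (f (x + h *: w) - f x)
    = h * (h * F (x + s *: v + t *: w)) ->
  f (x + h *: w + h *: v) - f (x + h *: w) - (f (x + h *: v) - f x)
    = h * (h * G (x + t' *: w + s' *: v)) ->
  F (x + s *: v + t *: w) = G (x + s' *: v + t' *: w).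
Proof.
move=> h0 E1; rewrite [x + h *: w + _]addrAC [x + t' *: w + _]addrAC => E2.
apply: (mulfI h0); apply: (mulfI h0); rewrite -E1 -E2 !opprB.
by rewrite addrACA [RHS]addrACA; congr (_ + _); exact: addrC.
Qed.

(** If the two mixed derivatives differed at [x], all their values near [x] would differ, whereas
    the second difference over a small parallelogram is symmetric in its sides and equals [h * h]
    times a value of each. *)
Lemma mixed_derivatives U f (x v w : V) : open U -> U x -> smooth U f ->
  'D_w ('D_v f) x = 'D_v ('D_w f) x.
Proof.
move=> oU Ux fs; apply/eqP/negPn/negP => ne.
have sv := smooth_derive v fs; have sw := smooth_derive w fs.
have ca := smooth_differentiable (smooth_derive w sv) Ux.
have cb := smooth_differentiable (smooth_derive v sw) Ux.
have [d d0 Hd] := continuous_separated oU Ux (differentiable_continuous ca)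
  (differentiable_continuous cb) ne.
(* As [h * n = d / 2], the whole parallelogram lies in the ball of radius [d]; the 1 keeps [n]
   positive when [v] and [w] vanish. *)
pose n := `|v| + `|w| + 1.
have n0 : 0 < n by apply: ltr_wpDl => //; apply: addr_ge0.
pose h := d / 2 / n.
have h0 : 0 < h by rewrite !divr_gt0.
have bd s t : 0 <= s <= h -> 0 <= t <= h -> ball x d (x + s *: v + t *: w).
  move=> /andP[s0 s1] /andP[t0 t1].
  rewrite -ball_normE /ball_ /= -addrA opprD addNKr normrN.
  apply: le_lt_trans (ler_normD _ _) _; rewrite !normrZ !ger0_norm //.
  apply: (@le_lt_trans _ _ (h * n)).
    rewrite /n mulrDr mulr1 mulrDr; apply: ler_wpDr; first exact: ltW.
    by apply: lerD; exact: ler_wpM2r.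
  by rewrite /h divfK ?gt_eqF // ltr_pdivrMr // ltr_pMr // ltr1n.
have [|s [t [s0 t0 E1]]] := @second_difference U f x v w h h0 fs.
  by move=> s t s0 t0; have [] := Hd _ _ (bd _ _ s0 t0) (bd _ _ s0 t0).
have [|t' [s' [t0' s0' E2]]] := @second_difference U f x w v h h0 fs.
  move=> t' s' ht hs; rewrite addrAC.
  by have [] := Hd _ _ (bd _ _ hs ht) (bd _ _ hs ht).
have wk (z : R) : 0 < z < h -> 0 <= z <= h by case/andP => /ltW -> /ltW ->.
have [_ /eqP] := Hd _ _ (bd _ _ (wk _ s0) (wk _ t0)) (bd _ _ (wk _ s0') (wk _ t0')).
move=> H; apply: H.
exact: (@square_differences_eq f ('D_w ('D_v f)) ('D_v ('D_w f)) x v w h s t s' t'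
  (lt0r_neq0 h0) E1 E2).
Qed.

End MixedDerivatives.

(** * Berwald functions and linear fields *)

Section LinearVerticalFields.
Variable R : realType.
Implicit Types (A : set (tpt R)) (L : tpt R -> R) (u v w : tpt R) (e : vec R).
Implicit Types N : vec R -> 'M[R]_4.

Lemma is_derive_entry m n (i : 'I_m) (j : 'I_n) (x v : 'M[R]_(m, n)) :
  is_derive x v (fun y : 'M[R]_(m, n) => y i j : R) (v i j).
Proof.
apply: (is_derive_linear (f := fun y : 'M[R]_(m, n) => y i j : R)) => h y z.
by rewrite !mxE.
Qed.

Lemma is_derive_fiber c u v : is_derive u v (fun w : tpt R => w.2 0 c) (v.2 0 c).
Proof. by apply: (is_derive_linear (f := fun w : tpt R => w.2 0 c : R)) => h y z; rewrite !mxE. Qed.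

Lemma differentiable_fiber c u : differentiable (fun w : tpt R => w.2 0 c) u.
Proof.
have ds := differentiable_snd u; have dc := differentiable_coord u.2 0 c.
exact: (@differentiable_comp _ _ _ _ _ (fun y : vec R => y 0 c) u ds dc).
Qed.

Lemma Cn_fiber n (U : set (tpt R)) c : Cn n U (fun w : tpt R => w.2 0 c).
Proof.
apply: (@Cn_linear R _ _ n U (fun w : tpt R => w.2 0 c : R)).
  exact: differentiable_fiber.
by move=> h y z; rewrite !mxE.
Qed.

Lemma is_derive_pair (V W1 W2 : normedModType R) (f : V -> W1) (g : V -> W2) (x v : V) a b :
  is_derive x v f a -> is_derive x v g b ->
  is_derive x v (fun y => (f y, g y)) (a, b).
Proof.
case=> df fa [dg gb].
have c : (fun h : R => h^-1 *: (((fun y => (f y, g y)) \o shift x) (h *: v)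
    - (f x, g x))) @ 0^' --> (a, b).
  by rewrite -fa -gb; apply: cvg_pair.
by split; [apply/cvg_ex; exists (a, b)|exact: cvg_lim].
Qed.

Lemma is_derive_mx (V : normedModType R) m n (f : V -> 'M[R]_(m, n)) (x v : V) (d : 'M[R]_(m, n)) :
  (forall i j, is_derive x v (fun y => f y i j) (d i j)) -> is_derive x v f d.
Proof.
move=> fd; have df : derivable f x v by apply/derivable_mxP => i j; have [] := fd i j.
split=> //; rewrite derive_mx //; apply/matrixP => i j; rewrite mxE.
by have [] := fd i j.
Qed.

(** The common form of all fields involved: constant on the base, linear in the fibre variable. For
    [delta] the base component is a coordinate vector, for brackets it is zero. *)
Definition vfield e N u : tpt R := (e, u.2 *m N u.1).

Definition dmx e N x : 'M[R]_4 := \matrix_(i, j) 'D_e (fun y => N y i j) x.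

Definition mxdiff N x := forall i j, differentiable (fun y => N y i j) x.

(** The matrix of the bracket of two such fields. As matrices act on the right, the commutator is
    [N *m N' - N' *m N]. *)
Definition mxlie e N e' N' x : 'M[R]_4 :=
  dmx e N' x - dmx e' N x + N x *m N' x - N' x *m N x.

Lemma is_derive_vfield_coord N u v c : mxdiff N u.1 ->
  is_derive u v (fun w => (w.2 *m N w.1) 0 c)
    ((v.2 *m N u.1 + u.2 *m dmx v.1 N u.1) 0 c).
Proof.
move=> dN; have -> : (fun w : tpt R => (w.2 *m N w.1) 0 c) =
    (fun w => \sum_b w.2 0 b * N w.1 b c) by rewrite funeqE => w; rewrite mxE.
have H b : is_derive u v (fun w : tpt R => w.2 0 b * N w.1 b c)
    (v.2 0 b * N u.1 b c + u.2 0 b * 'D_(v.1) (fun y => N y b c) u.1).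
  apply: is_derive_lam_mul; first exact: is_derive_fiber.
  by apply: (is_derive_fst (f := fun y => N y b c)); exact: diff_is_derive.
apply: is_derive_eq (is_derive_lam_sum H) _.
rewrite !mxE -big_split /=; apply: eq_bigr => b _; by rewrite !mxE.
Qed.

Lemma is_derive_vfield e N u v : mxdiff N u.1 ->
  is_derive u v (vfield e N) (0, v.2 *m N u.1 + u.2 *m dmx v.1 N u.1).
Proof.
move=> dN; apply: (is_derive_pair (f := fun=> e) (g := fun w => w.2 *m N w.1)).
by apply: is_derive_mx => i j; rewrite ord1; exact: is_derive_vfield_coord.
Qed.

Lemma lie_vfield e N e' N' u : mxdiff N u.1 -> mxdiff N' u.1 ->
  lie (vfield e N) (vfield e' N') u = vfield 0 (mxlie e N e' N') u.
Proof.
move=> dN dN'; rewrite /lie.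
have i1 := is_derive_vfield e (vfield e' N' u) dN.
have i2 := is_derive_vfield e' (vfield e N u) dN'.
rewrite !derive_val /vfield /mxlie /=; congr (_, _); first by rewrite /= subr0.
rewrite !mulmxDr !mulmxN !mulmxA /=.
by rewrite opprD addrACA addrC addrA.
Qed.

Lemma derive_vertical L u e z : differentiable L u ->
  'D_(e, z) L u = 'D_(e, 0) L u + \sum_c z 0 c * dy c L u.
Proof.
move=> dL; have -> : (e, z) = (e, 0) + (0, z) :> tpt R.
  by congr (_, _); rewrite ?addr0 ?add0r.
rewrite deriveDdir //; congr (_ + _).
have -> : (0, z) = \sum_c z 0 c *: (0, delta_mx 0 c) :> tpt R.
  rewrite [z in LHS]row_sum_delta.
  elim/big_rec2: _ => // c y1 y2 _ <-.
  by congr (_, _); rewrite /= ?scaler0 ?addr0.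
rewrite derive_sumdir //; apply: eq_bigr => c _.
by rewrite deriveZdir.
Qed.

End LinearVerticalFields.

(** * Fields annihilating a function, and their brackets *)

Section BerwaldCondition.
Variable R : realType.
Implicit Types (A : set (tpt R)) (L : tpt R -> R) (u v w : tpt R) (e : vec R).
Implicit Types (N : vec R -> 'M[R]_4) (G : coefs R).

Definition annihilates A L (X : tpt R -> tpt R) := forall u, A u -> 'D_(X u) L u = 0.

(* The equation X L = 0 differentiated in the direction w: the Hessian of L
   applied to (X, w), plus the derivative of L along that of X. *)
Lemma annihilates_derive A L e N u w : open A -> smooth A L ->
  (forall u, A u -> mxdiff N u.1) -> annihilates A L (vfield e N) -> A u ->
  'D_(vfield e N u) ('D_w L) u
    + 'D_(0, w.2 *m N u.1 + u.2 *m dmx w.1 N u.1) L u = 0.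
Proof.
move=> oA sL dN XL Au; have dL v : A v -> differentiable L v by exact: smooth_differentiable.
have dDL w' : differentiable ('D_w' L) u.
  exact: smooth_differentiable (smooth_derive w' sL) Au.
have i1 := diff_is_derive w (dDL (e, 0)).
have H c := is_derive_lam_mul (is_derive_vfield_coord w c (dN _ Au))
   (diff_is_derive w (dDL (0, delta_mx 0 c))).
have i2 := is_derive_lam_add i1 (is_derive_lam_sum H).
have ann0 y : A y -> 'D_(e, 0) L y +
    \sum_i (y.2 *m N y.1) 0 i * 'D_(0, delta_mx 0 i) L y = 0.
  by move=> Ay; rewrite -(derive_vertical e _ (dL _ Ay)) XL.
have := is_deriveE (eq_is_derive_open oA Au ann0 i2).
rewrite (is_deriveE (is_derive_lam_cst (0 : R) u w)) => /esym E.
have M w' : 'D_w' ('D_w L) u = 'D_w ('D_w' L) u by exact: mixed_derivatives oA Au sL.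
have -> : 'D_(vfield e N u) ('D_w L) u = 'D_w ('D_(e, 0) L) u +
    \sum_c (u.2 *m N u.1) 0 c * 'D_w ('D_(0, delta_mx 0 c) L) u.
  apply: etrans (derive_vertical e (u.2 *m N u.1) (dDL w)) _.
  apply: (congr2 +%R); first exact: M.
  apply: eq_bigr => c _.
  apply: (congr2 *%R); first by [].
  exact: M.
rewrite (derive_vertical 0 _ (dL _ Au)) (derive0 L u : 'D_(0, 0) L u = 0) add0r.
by rewrite -[RHS]E big_split /= addrA addrAC.
Qed.

(** Apply [annihilates_derive] to each field with the other one as direction. The Hessian terms
    agree by symmetry, and subtraction leaves the derivative of [L] along the bracket. *)
Lemma annihilates_lie A L e N e' N' : open A -> smooth A L ->
  (forall u, A u -> mxdiff N u.1) -> (forall u, A u -> mxdiff N' u.1) ->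
  annihilates A L (vfield e N) -> annihilates A L (vfield e' N') ->
  annihilates A L (vfield 0 (mxlie e N e' N')).
Proof.
move=> oA sL dN dN' XL YL u Au.
have dL : differentiable L u by exact: smooth_differentiable sL Au.
have E1 := annihilates_derive (vfield e' N' u) oA sL dN XL Au.
have E2 := annihilates_derive (vfield e N u) oA sL dN' YL Au.
rewrite (mixed_derivatives _ _ oA Au sL) in E1.
have aux (a b c : R) : a + b = 0 -> a + c = 0 -> c - b = 0.
  move=> ab ac; have -> : c - b = (a + c) - (a + b).
    by rewrite opprD addrACA subrr add0r.
  by rewrite ab ac subrr.
have := aux _ _ _ E1 E2; rewrite !deriveE // => <-; rewrite -linearB /=.
congr ('d L u _); congr (_, _); first by rewrite /= subr0.
rewrite /mxlie /= !mulmxDr !mulmxN !mulmxA /=.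
by apply/esym; rewrite opprD addrACA addrC addrA.
Qed.

(* Matrices act on row vectors from the right: the entry in row b and column c is
   the coefficient of xdot^b in the component c of delta_a. *)
Definition conn G (a : 'I_4) x : 'M[R]_4 := \matrix_(b, c) - G x c a b.

Lemma delta_vfield G a : delta G a = vfield (delta_mx 0 a) (conn G a).
Proof.
rewrite funeqE => u; congr (_, _); apply/rowP => c; rewrite !mxE -sumrN.
by apply: eq_bigr => b _; rewrite mxE mulrN mulrC.
Qed.

End BerwaldCondition.

(** * Canonical connection and annihilation by the horizontal fields *)

Section BerwaldEquivalence.
Variable R : realType.
Implicit Types (M : set (vec R)) (A : set (tpt R)) (L : tpt R -> R) (u v w : tpt R).
Implicit Types (G : coefs R).

Definition nonlin G u (a c : 'I_4) := \sum_d G u.1 c a d * u.2 0 d.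

Definition gspray G u c := \sum_a \sum_b G u.1 c a b * u.2 0 a * u.2 0 b.

Lemma gsprayE G u c : gspray G u c = \sum_a u.2 0 a * nonlin G u a c.
Proof.
apply: eq_bigr => a _; rewrite mulr_sumr; apply: eq_bigr => b _.
by rewrite mulrCA mulrA.
Qed.

Lemma derive_delta G L u a : differentiable L u ->
  'D_(delta G a u) L u = dx a L u - \sum_c nonlin G u a c * dy c L u.
Proof.
move=> dL; rewrite derive_vertical // -sumrN; congr (_ + _).
by apply: eq_bigr => c _; rewrite !mxE mulNr.
Qed.

(** Differentiate the homogeneity relation for the factor [1 + h] at [h = 0]; it is available for
    [-1 < h], where the factor is positive. *)
Lemma euler M A L u : finsler M A L -> A u ->
  \sum_c u.2 0 c * dy c L u = 2 * L u.
Proof.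
case=> -[oA _ _ _] sL hL _ Au.
have dL : differentiable L u by exact: smooth_differentiable sL Au.
have := derive_vertical 0 u.2 dL; rewrite (derive0 L u : 'D_(0, 0) L u = 0) add0r => <-.
have i1 : is_derive (0 : R) (1 : R) (fun h => L (u + h *: (0, u.2))) ('D_(0, u.2) L u).
  apply: is_derive_line; rewrite scale0r addr0; exact: diff_is_derive.
have i2 : is_derive (0 : R) (1 : R) (fun h : R => (1 + h) ^+ 2 * L u) (2 * L u).
  have i3 := is_derive_lam_add (is_derive_lam_cst (1 : R) (0 : R) (1 : R))
     (is_derive_id (0 : R) (1 : R)).
  have i4 := is_derive_lam_mul (is_derive_lam_mul i3 i3)
     (is_derive_lam_cst (L u) (0 : R) (1 : R)).
  by apply: is_derive_eq i4 _; rewrite /=; ring.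
have E h : -1 < h -> (1 + h) ^+ 2 * L u = L (u + h *: (0, u.2)).
  move=> h1; case: u Au {dL i1 i2} => x y Au /=.
  rewrite -hL //; last by rewrite -ltrBlDl sub0r.
  by congr (L (_, _)); rewrite /= ?scaler0 ?addr0 // scalerDl scale1r.
have i5 := eq_is_derive_open (@open_gt R (-1)) _ E i2.
have /i5 i6 : (-1 < (0 : R)) by rewrite oppr_lt0.
by rewrite -(is_deriveE i1) (is_deriveE i6).
Qed.

Lemma euler_derive M A L u w : finsler M A L -> A u ->
  \sum_c u.2 0 c * 'D_w (dy c L) u = 2 * 'D_w L u - 'D_(0, w.2) L u.
Proof.
move=> fL Au; have [[oA _ _ _] sL _ _] := fL.
have dL : differentiable L u by exact: smooth_differentiable sL Au.
have dyL c : differentiable (dy c L) u.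
  exact: smooth_differentiable (smooth_derive _ sL) Au.
have i1 := is_derive_lam_sum (fun c => is_derive_lam_mul (is_derive_fiber c u w)
   (diff_is_derive w (dyL c))).
have i2 := is_derive_lam_mul (is_derive_lam_cst (2 : R) u w) (diff_is_derive w dL).
have i3 := eq_is_derive_open oA Au (fun v Av => euler fL Av) i1.
have := is_deriveE i3; rewrite (is_deriveE i2).
rewrite mul0r add0r big_split /= => ->.
rewrite (derive_vertical 0 w.2 dL) (derive0 L u : 'D_(0, 0) L u = 0) add0r.
by rewrite addrAC subrr add0r.
Qed.

Definition spray_covector L u b := \sum_c u.2 0 c * dx c (dy b L) u - dx b L u.

(** The spray is a quarter of the inverse of [g] applied to the covector, and the fibre Hessian of
    [L] is twice [g], so the inverse can be moved to the other side. *)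
Lemma geodesic_sprayP L u (S : 'I_4 -> R) : fundamental_tensor L u \in unitmx ->
  (forall c, 2 * geodesic_spray L u c = S c) <->
  (forall b, spray_covector L u b = \sum_c S c * dy b (dy c L) u).
Proof.
move=> ug; set g := fundamental_tensor L u in ug *.
pose E := \col_b spray_covector L u b; pose s := \col_c S c.
have gE : \col_c (2 * geodesic_spray L u c) = 2^-1 *: (invmx g *m E).
  apply/colP => c; rewrite !mxE /geodesic_spray -/g.
  have -> : 2 * (4^-1 * \sum_(b < 4) invmx g c b *
     (\sum_(c0 < 4) u.2 0 c0 * dx c0 (dy b L) u - dx b L u)) =
    2^-1 * \sum_(b < 4) invmx g c b * spray_covector L u b.
    by rewrite mulrA; congr (_ * _); lra.
  by congr (_ * _); apply: eq_bigr => b _; rewrite mxE.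
have gs : 2 *: (g *m s) = \col_b \sum_c S c * dy b (dy c L) u.
  apply/colP => b; rewrite !mxE mulr_sumr; apply: eq_bigr => c _.
  by rewrite !mxE !mulrA mulfV // mul1r mulrC.
split=> H.
- have Es : 2^-1 *: (invmx g *m E) = s by rewrite -gE; apply/colP => c; rewrite !mxE.
  have : E = \col_b \sum_c S c * dy b (dy c L) u.
    by rewrite -gs -Es -scalemxAr scalerA mulfV // scale1r mulKVmx.
  by move=> /colP EE b; have := EE b; rewrite !mxE.
- have : E = 2 *: (g *m s) by rewrite gs; apply/colP => b; rewrite !mxE.
  move=> EE c; have /colP/(_ c) := gE.
  by rewrite EE -scalemxAr mulKmx // scalerA mulVf // scale1r !mxE.
Qed.

Lemma is_derive_gspray G u c z :
  is_derive u (0, z) (fun v => gspray G v c)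
   (\sum_a \sum_b G u.1 c a b * (z 0 a * u.2 0 b + u.2 0 a * z 0 b)).
Proof.
apply: is_derive_lam_sum => a; apply: is_derive_lam_sum => b.
have i1 := @is_derive_fst R _ (vec R) R (fun x => G x c a b) (0, z) u 0
  (is_derive0 _ _).
have i2 := is_derive_fiber a u (0, z); have i3 := is_derive_fiber b u (0, z).
apply: is_derive_eq (is_derive_lam_mul (is_derive_lam_mul i1 i2) i3) _.
by rewrite mul0r add0r mulrDr !mulrA.
Qed.

(** Contracting the spray equation with xdot and using Euler's identity gives [SL]: the spray
    annihilates [L]. The derivative of [SL] along the fibre coordinate [a], minus the spray equation
    of index [a], is twice delta_a L. *)
Lemma canonical_annihilates M A L G a : finsler M A L ->
  canonical_connection M A L G -> annihilates A L (delta G a).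
Proof.
move=> fL [[_ Gsym] can]; have [[oA slA _ _] sL _ ug] := fL.
have dL v : A v -> differentiable L v by exact: smooth_differentiable.
have spr v : A v -> forall b, spray_covector L v b =
    \sum_c gspray G v c * dy b (dy c L) v.
  by move=> Av; apply/geodesic_sprayP; [exact: ug|move=> c; exact: can].
have SL v : A v -> \sum_c (v.2 0 c * dx c L v - gspray G v c * dy c L v) = 0.
  move=> Av; rewrite big_split /= sumrN; apply/eqP; rewrite subr_eq0; apply/eqP.
  have twice (a0 : R) : 2 * a0 - a0 = a0 by rewrite mulr2n mulrDl mul1r addrK.
  have dxE c : \sum_b v.2 0 b * dx c (dy b L) v = 2 * dx c L v.
    apply: etrans (euler_derive (delta_mx 0 c, 0) fL Av) _.
    by rewrite (derive0 L v : 'D_(0, 0) L v = 0) subr0.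
  have dyE c : \sum_b v.2 0 b * dy b (dy c L) v = dy c L v.
    apply: etrans (twice _).
    apply: etrans (euler_derive (0, delta_mx 0 c) fL Av).
    apply: eq_bigr => b _; apply: (congr1 ( *%R _)).
    exact: mixed_derivatives oA Av sL.
  have e1 : \sum_b v.2 0 b * spray_covector L v b = \sum_c v.2 0 c * dx c L v.
    transitivity (\sum_b (\sum_c v.2 0 c * (v.2 0 b * dx c (dy b L) v)
        - v.2 0 b * dx b L v)).
      apply: eq_bigr => b _; rewrite /spray_covector mulrBr mulr_sumr.
      by apply: (congr2 +%R) => //; apply: eq_bigr => c _; exact: mulrCA.
    rewrite big_split /= sumrN exchange_big /= -[RHS]twice; apply: (congr2 +%R) => //.
    rewrite mulr_sumr; apply: eq_bigr => c _.
    by rewrite -mulr_sumr dxE mulrCA.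
  have e2 : \sum_b v.2 0 b * (\sum_c gspray G v c * dy b (dy c L) v) =
      \sum_c gspray G v c * dy c L v.
    transitivity (\sum_b \sum_c gspray G v c * (v.2 0 b * dy b (dy c L) v)).
      apply: eq_bigr => b _; rewrite mulr_sumr.
      by apply: eq_bigr => c _; exact: mulrCA.
    by rewrite exchange_big /=; apply: eq_bigr => c _; rewrite -mulr_sumr dyE.
  by apply: etrans (esym e1) (etrans _ e2); apply: eq_bigr => b _; rewrite spr.
move=> u Au; rewrite (derive_delta G a (dL _ Au)).
pose z : vec R := delta_mx 0 a.
have dxyL w : differentiable ('D_w L) u.
  exact: smooth_differentiable (smooth_derive _ sL) Au.
have i1 := is_derive_lam_sum (fun c => is_derive_lam_add
  (is_derive_lam_mul (is_derive_fiber c u (0, z)) (diff_is_derive (0, z) (dxyL (delta_mx 0 c, 0))))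
  (is_derive_lam_opp (is_derive_lam_mul (is_derive_gspray G u c z)
      (diff_is_derive (0, z) (dxyL (0, delta_mx 0 c)))))).
have i2 := eq_is_derive_open oA Au SL i1.
have := is_deriveE i2.
rewrite (is_deriveE (is_derive_lam_cst (0 : R) u (0, z))) => /esym.
have zE (F : 'I_4 -> R) : \sum_i z 0 i * F i = F a.
  rewrite (bigD1 a) //= mxE !eqxx mul1r big1 ?addr0 // => i ia.
  by rewrite mxE (negbTE ia) andbF mul0r.
have s2 : \sum_i u.2 0 i * 'D_(0, z) ('D_(delta_mx 0 i, 0) L) u =
    \sum_c gspray G u c * 'D_(0, z) ('D_(0, delta_mx 0 c) L) u + dx a L u.
  have /eqP := spr _ Au a; rewrite subr_eq => /eqP <-; apply: eq_bigr => i _.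
  apply: (congr1 ( *%R _)); exact: mixed_derivatives oA Au sL.
(* The factor 2 comes from the symmetry of the coefficients in their lower indices. *)
have s3 : \sum_c (\sum_i \sum_b G u.1 c i b * (z 0 i * u.2 0 b + u.2 0 i * z 0 b))
     * 'D_(0, delta_mx 0 c) L u = 2 * \sum_c nonlin G u a c * dy c L u.
  rewrite mulr_sumr; apply: eq_bigr => c _; rewrite mulrA; apply: (congr2 *%R) => //.
  transitivity (\sum_i (z 0 i * nonlin G u i c
      + u.2 0 i * \sum_b z 0 b * G u.1 c i b)).
    apply: eq_bigr => i _; rewrite !mulr_sumr -big_split /=.
    by apply: eq_bigr => b _; ring.
  rewrite big_split /= zE mulr2n mulrDl mul1r; congr (_ + _).
  apply: eq_bigr => i _; rewrite zE mulrC Gsym //; have [] := slA _ Au => //.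
have splitE (p X q XX P Y Q YY : 'I_4 -> R) :
    \sum_i (p i * X i + q i * XX i + - (P i * Y i + Q i * YY i)) =
    \sum_i p i * X i + \sum_i q i * XX i - (\sum_i P i * Y i + \sum_i Q i * YY i).
  by rewrite sumrB !big_split.
have fin (A' B C D x y t : R) : A' = x -> B = t + x -> C = 2 * y -> D = t ->
    A' + B - (C + D) = 0 -> x - y = 0.
  move=> -> -> -> -> H; have : 2 * (x - y) = 0 by rewrite -[RHS]H; ring.
  by move=> /eqP; rewrite mulf_eq0 pnatr_eq0 /= => /eqP.
move/(etrans (esym (splitE _ _ _ _ _ _ _ _))).
exact: fin (zE _) s2 s3 erefl.
Qed.

(** Differentiate delta_a L = 0 along the fibre coordinate [b] and contract with xdot. The term in
    which the coefficients themselves are contracted is [dx b L], by delta_b L = 0 and the symmetry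
    of [G]. *)
Lemma annihilates_canonical M A L G : finsler M A L ->
  torsion_free_connection M G -> (forall a, annihilates A L (delta G a)) ->
  canonical_connection M A L G.
Proof.
move=> fL tG aL; have [[oA slA _ _] sL _ ug] := fL; have [sG Gsym] := tG.
split=> // u c Au; move: c.
have Mu : M u.1 by have [] := slA _ Au.
have dL : differentiable L u by exact: smooth_differentiable sL Au.
have dxyL w : differentiable ('D_w L) u.
  exact: smooth_differentiable (smooth_derive _ sL) Au.
have dN a v : A v -> mxdiff (conn G a) v.1.
  move=> Av i j.
  rewrite (_ : (fun x => conn G a x i j) = fun x => - G x j a i); last first.
    by rewrite funeqE => x; rewrite mxE.
  apply: (@differentiableN R _ _ (fun x => G x j a i)).
  by apply: smooth_differentiable (sG j a i) _; have [] := slA _ Av.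
apply/(@geodesic_sprayP L u (gspray G u) (ug _ Au)) => b.
have E a : dx a (dy b L) u - \sum_c nonlin G u a c * dy c (dy b L) u
   - \sum_d G u.1 d a b * dy d L u = 0.
  have aN : annihilates A L (vfield (delta_mx 0 a) (conn G a)).
    by rewrite -delta_vfield.
  have := annihilates_derive (0, delta_mx 0 b) oA sL (dN a) aN Au.
  rewrite -delta_vfield derive_delta // => H; rewrite -[RHS]H; congr (_ + _).
  rewrite derive_vertical // (derive0 L u : 'D_(0, 0) L u = 0) add0r -sumrN.
  apply: eq_bigr => d _; rewrite -mulNr; congr (_ * _).
  have -> : dmx 0 (conn G a) u.1 = 0.
    by apply/matrixP => i j; rewrite !mxE derive0.
  by rewrite mulmx0 addr0 -rowE !mxE.
have {}E : \sum_a u.2 0 a * (dx a (dy b L) u - \sum_c nonlin G u a c * dy c (dy b L) u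
   - \sum_d G u.1 d a b * dy d L u) = 0.
  by rewrite big1 // => a _; rewrite E mulr0.
have splitE (p P Q T : 'I_4 -> R) : \sum_i p i * (P i - Q i - T i) =
    \sum_i p i * P i - \sum_i p i * Q i - \sum_i p i * T i.
  by rewrite -!sumrB; apply: eq_bigr => i _; rewrite !mulrBr.
have q : \sum_a u.2 0 a * (\sum_c nonlin G u a c * dy c (dy b L) u) =
    \sum_c gspray G u c * dy b (dy c L) u.
  transitivity (\sum_a \sum_c u.2 0 a * nonlin G u a c * dy c (dy b L) u).
    apply: eq_bigr => a _; rewrite mulr_sumr.
    by apply: eq_bigr => c _; exact: mulrA.
  rewrite exchange_big /=; apply: eq_bigr => c _; rewrite -mulr_suml -gsprayE.
  apply: (congr1 ( *%R _)); exact: mixed_derivatives oA Au sL.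
have t : \sum_a u.2 0 a * (\sum_d G u.1 d a b * dy d L u) = dx b L u.
  have /eqP := aL b u Au; rewrite derive_delta // subr_eq0 => /eqP ->.
  transitivity (\sum_a \sum_d u.2 0 a * G u.1 d a b * dy d L u).
    apply: eq_bigr => a _; rewrite mulr_sumr.
    by apply: eq_bigr => d _; exact: mulrA.
  rewrite exchange_big /=; apply: eq_bigr => d _; rewrite -mulr_suml.
  apply: (congr2 *%R) => //; apply: eq_bigr => a _.
  by rewrite mulrC Gsym.
have fin (a0 b0 c b' c' : R) : b0 = b' -> c = c' -> a0 - b0 - c = 0 -> a0 - c' = b'.
  by move=> -> -> /eqP; rewrite addrAC subr_eq0 => /eqP.
move/(etrans (esym (splitE _ _ _ _))): E.
exact: fin q t.
Qed.

End BerwaldEquivalence.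

(** * Linear fields annihilating a Finsler function on a fibre *)

Section FibreForms.
Variable R : realType.
Implicit Types (S N : 'M[R]_4) (y z : vec R) (O : set (vec R)).

Lemma sum4 (V : nmodType) (F : 'I_4 -> V) :
  \sum_i F i = F it + (F ir + (F ith + F iph)).
Proof.
rewrite !big_ord_recl big_ord0 addr0.
by congr (F _ + (F _ + (F _ + F _))); apply: val_inj.
Qed.

Lemma ord4P (P : 'I_4 -> Prop) : P it -> P ir -> P ith -> P iph -> forall i, P i.
Proof.
move=> P0 P1 P2 P3 [[|[|[|[|//]]]] Hi].
- by rewrite (_ : Ordinal Hi = it) //; apply: val_inj.
- by rewrite (_ : Ordinal Hi = ir) //; apply: val_inj.
- by rewrite (_ : Ordinal Hi = ith) //; apply: val_inj.
- by rewrite (_ : Ordinal Hi = iph) //; apply: val_inj.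
Qed.

Definition qform S y : R := \sum_i \sum_j S i j * y 0 i * y 0 j.

Lemma Cn_coord n (U : set (vec R)) i : Cn n U (fun y : vec R => y 0 i : R).
Proof.
apply: (@Cn_linear R _ _ n U (fun y : vec R => y 0 i : R)).
  by move=> x; exact: differentiable_coord.
by move=> h y z; rewrite !mxE.
Qed.

Lemma continuous_qform S y : {for y, continuous (qform S)}.
Proof.
have C : Cn 0 setT (qform S).
  apply: Cn_sum => [|i]; first exact: openT.
  apply: Cn_sum => [|j]; first exact: openT.
  apply: CnM; [exact: openT| |exact: Cn_coord].
  by apply: CnM; [exact: openT|exact: Cn_cst|exact: Cn_coord].
exact: C.
Qed.

Lemma open_qform_neq0 O S : open O -> open [set y | O y /\ qform S y != 0].
Proof.
move=> oO; rewrite openE => y [Oy Sy].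
have nO : \forall z \near y, O z by exact: near_open oO Oy _.
have nS : \forall z \near y, qform S z != 0.
  exact: (continuous_qform (S := S) (y := y) (open_nbhs_nbhs (conj (@open_neq R 0) Sy))).
exact: filterS2 nO nS.
Qed.

Lemma qform_parallelogram S y z (h : R) :
  qform S (y + h *: z) + qform S (y - h *: z) = 2 * qform S y + 2 * h ^+ 2 * qform S z.
Proof.
rewrite /qform -big_split !mulr_sumr -big_split; apply: eq_bigr => i _ /=.
rewrite -big_split !mulr_sumr -big_split; apply: eq_bigr => j _ /=.
rewrite !mxE; ring.
Qed.

(** For small [h] the points [y], [y + h *: z] and [y - h *: z] all lie in [O], and the
    parallelogram identity isolates [qform S z]. *)
Lemma qform_open0 O S y : open O -> O y -> (forall z, O z -> qform S z = 0) ->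
  forall z, qform S z = 0.
Proof.
move=> oO Oy SO z.
have /nbhs_ballP[d /= d0 Hd] : nbhs y O by exact: open_nbhs_nbhs.
have n0 : 0 < `|z| + 1 by apply: ltr_wpDl => //.
pose h := d / 2 / (`|z| + 1).
have h0 : 0 < h by rewrite !divr_gt0.
have hz : `|h *: z| < d.
  rewrite normrZ gtr0_norm //; apply: (@le_lt_trans _ _ (h * (`|z| + 1))).
    by apply: ler_wpM2l; [exact: ltW|rewrite lerDl].
  by rewrite /h divfK ?gt_eqF // ltr_pdivrMr // ltr_pMr // ltr1n.
have O1 : O (y + h *: z).
  by apply: Hd; rewrite -ball_normE /ball_ /= opprD addNKr normrN.
have O2 : O (y - h *: z).
  by apply: Hd; rewrite -ball_normE /ball_ /= opprB addrC subrK.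
have := qform_parallelogram S y z h.
rewrite (SO _ O1) (SO _ O2) (SO _ Oy) addr0 mulr0 add0r => /esym/eqP.
by clearbody h; rewrite !mulf_eq0 pnatr_eq0 (gt_eqF h0) /= => /eqP.
Qed.

(** Moves a point of an open set off the zero set of a form that is known to be nonzero at some
    vector, possibly outside the set. *)
Lemma qform_dense O S y z : open O -> O y -> qform S z != 0 ->
  exists2 y', O y' & qform S y' != 0.
Proof.
move=> oO Oy Sz; apply: contrapT => H; move/eqP: Sz; apply.
apply: (qform_open0 oO Oy) => y' Oy'; apply: contrapT => /eqP Sy'.
by apply: H; exists y'.
Qed.

End FibreForms.

(** * Linear symmetries of L on one fibre *)

Section FibreNondegeneracy.
Variable R : realType.
Implicit Types (M : set (vec R)) (A : set (tpt R)) (L : tpt R -> R).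
Implicit Types (N : 'M[R]_4) (x y z : vec R) (O : set (vec R)).

Lemma open_fibre A x : open A -> open [set y | A (x, y)].
Proof.
move=> oA; rewrite openE => y Ay.
have : \forall u \near (x, y), A u by exact: near_open oA Ay _.
move=> /nbhs_ballP[d /= d0 Hd]; apply/nbhs_ballP; exists d => //= z yz.
by apply: Hd; split => //=; exact: ballxx.
Qed.

Lemma derive_fibre0 (F : tpt R -> R) O x y v : open O -> O y ->
  (forall z, O z -> F (x, z) = 0) -> 'D_(0, v) F (x, y) = 0.
Proof.
move=> oO Oy FO.
have -> : 'D_(0, v) F (x, y) = 'D_v (fun z => F (x, z)) y.
  rewrite /derive; set p := fun h : R => _; set q := fun h : R => _.
  suff -> : p = q by [].
  rewrite funeqE => h; rewrite /p /q /=; congr (_ *: (F _ - _)); congr (_, _).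
  by rewrite /= scaler0 add0r.
rewrite (eq_derive_open v oO Oy FO); exact: (derive_cst (0 : R)).
Qed.

(** Differentiating once more along the fibre puts [z] in the kernel of the fundamental tensor,
    which is invertible. *)
Lemma fibre_nondegenerate M A L O x y z : finsler M A L -> open O -> O y ->
  (forall y', O y' -> A (x, y') /\ 'D_(0, z) L (x, y') = 0) -> z = 0.
Proof.
move=> [[oA _ _ _] sL _ ug] oO Oy H; have [Axy _] := H _ Oy.
have dyL b : differentiable (dy b L) (x, y).
  exact: smooth_differentiable (smooth_derive _ sL) Axy.
have zg : z *m fundamental_tensor L (x, y) = 0.
  apply/rowP => b; rewrite !mxE.
  transitivity (2^-1 * 'D_(0, z) (dy b L) (x, y)).
    rewrite (derive_vertical 0 z (dyL b)) (derive0 (dy b L) (x, y) : 'D_(0, 0) _ _ = 0).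
    rewrite add0r mulr_sumr; apply: eq_bigr => c _.
    by rewrite mxE mulrCA.
  have -> : 'D_(0, z) (dy b L) (x, y) = 0; last by rewrite mulr0.
  apply: etrans (mixed_derivatives _ _ oA Axy sL) _.
  by apply: (derive_fibre0 _ oO Oy) => y' /H[].
by rewrite -[z](mulmxK (ug _ Axy)) zg mul0mx.
Qed.

Definition killing A L x N := forall y, A (x, y) -> 'D_(0, y *m N) L (x, y) = 0.

(** Cramer's rule in the plane of the coordinates [j] and [l]. *)
Lemma minor_combination (a b : vec R) j l : j != l ->
  a 0 j * b 0 l - a 0 l * b 0 j != 0 ->
  (forall k, k != j -> k != l -> a 0 k = 0 /\ b 0 k = 0) ->
  delta_mx 0 j = (b 0 l / (a 0 j * b 0 l - a 0 l * b 0 j)) *: a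
     + (- a 0 l / (a 0 j * b 0 l - a 0 l * b 0 j)) *: b.
Proof.
move=> jl p0 H; apply/rowP => k; rewrite !mxE eqxx /=.
have [->|kj] := eqVneq k j; first by rewrite /=; field.
have [->|kl] := eqVneq k l; first by rewrite /=; field.
by have [-> ->] := H _ kj kl; rewrite !mulr0 addr0.
Qed.

(* If the minor is nonzero at y, then y *m N and y *m N' span the j-th direction,
   along which L is then constant on an open subset of the fibre. *)
Lemma killing_minor M A L x N N' y0 j l : finsler M A L -> A (x, y0) -> j != l ->
  killing A L x N -> killing A L x N' ->
  (forall k m, k != j -> k != l -> N m k = 0 /\ N' m k = 0) ->
  forall y, (y *m N) 0 j * (y *m N') 0 l - (y *m N) 0 l * (y *m N') 0 j = 0.
Proof.
move=> fL Ay0 jl kN kN' NN' y; have [[oA _ _ _] sL _ _] := fL.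
(* The minor is quadratic in the fibre variable, so [qform_dense] makes it nonzero somewhere on the
   fibre of [A] once it is nonzero at all. *)
pose S := \matrix_(i, k) (N i j * N' k l - N i l * N' k j).
have SE z : (z *m N) 0 j * (z *m N') 0 l - (z *m N) 0 l * (z *m N') 0 j = qform S z.
  rewrite !mxE !big_distrlr /= -sumrB; apply: eq_bigr => i _.
  by rewrite -sumrB; apply: eq_bigr => k _; rewrite mxE; ring.
rewrite SE; apply: contrapT => /eqP Sy.
have oAx := open_fibre (x := x) oA.
have [y1 Ay1 Sy1] := qform_dense oAx Ay0 Sy.
have : delta_mx 0 j = 0 :> vec R.
  apply: (fibre_nondegenerate (x := x)
    (O := [set z | A (x, z) /\ qform S z != 0]) fL _ (conj Ay1 Sy1)).
    exact: open_qform_neq0.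
  move=> z [Az Sz]; split=> //.
  have dL : differentiable L (x, z) by exact: smooth_differentiable sL Az.
  rewrite -SE in Sz; set p := _ - _ in Sz.
  have E : (0, delta_mx 0 j) = ((z *m N') 0 l / p) *: (0, z *m N)
       + (- (z *m N) 0 l / p) *: (0, z *m N') :> tpt R.
    congr (_, _); first by rewrite /= !scaler0 addr0.
    apply: minor_combination => // k kj kl.
    by split; rewrite mxE big1 // => m _; have [E1 E2] := NN' k m kj kl;
      rewrite ?E1 ?E2 mulr0.
  rewrite E.
  rewrite deriveDdir // !deriveZdir // kN // kN' //.
  by rewrite !scaler0 addr0.
move=> /rowP/(_ j); rewrite !mxE !eqxx => /eqP; by rewrite oner_eq0.
Qed.

(* For N of rank one, y *m N is a multiple of row i of N, a direction not
   depending on y. *)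
Lemma killing_rank1 M A L x N y0 i j : finsler M A L -> A (x, y0) ->
  killing A L x N -> (forall k l, N i j * N k l = N k j * N i l) -> N i j = 0.
Proof.
move=> fL Ay0 kN rk; have [[oA _ _ _] sL _ _] := fL.
apply: contrapT => /eqP Nij.
(* The square of the linear form [(z *m N) 0 j], written as a quadratic form so that [qform_dense]
   applies. *)
pose S := \matrix_(k, l) (N k j * N l j).
have SE z : qform S z = (z *m N) 0 j ^+ 2.
  rewrite expr2 mxE big_distrlr /=; apply: eq_bigr => k _.
  by apply: eq_bigr => l _; rewrite mxE; ring.
have oAx := open_fibre (x := x) oA.
have Si : qform S (delta_mx 0 i) != 0.
  by rewrite SE -rowE mxE expf_eq0 /=.
have [y1 Ay1 Sy1] := qform_dense oAx Ay0 Si.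
have : row i N = 0.
  apply: (fibre_nondegenerate (x := x)
    (O := [set z | A (x, z) /\ qform S z != 0]) fL _ (conj Ay1 Sy1)).
    exact: open_qform_neq0.
  move=> z [Az]; rewrite SE expf_eq0 /= => zj; split=> //.
  have dL : differentiable L (x, z) by exact: smooth_differentiable sL Az.
  have E : (0, row i N) = (N i j / (z *m N) 0 j) *: (0, z *m N) :> tpt R.
    congr (_, _); first by rewrite /= scaler0.
    apply/rowP => l; rewrite [LHS]mxE [RHS]mxE.
    have key : N i j * (z *m N) 0 l = (z *m N) 0 j * N i l.
      rewrite !mxE mulr_sumr mulr_suml; apply: eq_bigr => k _.
      by rewrite mulrCA rk mulrA.
    by rewrite mulrAC key mulrAC mulfV // mul1r.
  by rewrite E deriveZdir // kN // scaler0.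
by move=> /rowP/(_ j); rewrite !mxE => E; rewrite E eqxx in Nij.
Qed.

End FibreNondegeneracy.

(** * Curvature of the class 5 connection *)

Section CurvatureTable.
Variables (R : realType) (M : set (vec R)) (K : sphcoef R).
Hypothesis oM : open M.
Hypothesis Mchart : M `<=` @sph_chart R.
Hypothesis tfK : torsion_free_connection M (sphG K).
Hypothesis K0 : forall x : vec R, M x -> let t := x 0 it in let r := x 0 ir in
  [/\ k7 K t r = 0, k8 K t r = 0, k9 K t r = 0 & k10 K t r = 0].

(* On M, conn (sphG K) b is minus the sum of trcoef and angcoef, the entries of
   conn (sphG K) b involving k7, ..., k10 being zero there. *)
Definition trcoef (b i j : nat) : R -> R -> R :=
  match b, i, j with
  | 0, 0, 0 => k1 K | 0, 0, 1 => k4 K | 0, 1, 0 => k2 K | 0, 1, 1 => k6 K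
  | 1, 0, 0 => k2 K | 1, 0, 1 => k6 K | 1, 1, 0 => k3 K | 1, 1, 1 => k5 K
  | _, _, _ => fun _ _ => 0%R
  end%N.

Definition angcoef (b i j : nat) : R -> R :=
  match b, i, j with
  | 2, 3, 3 | 3, 2, 3 => fun th => (cos th / sin th)%R
  | 3, 3, 2 => fun th => (- (sin th * cos th))%R
  | _, _, _ => fun=> 0%R
  end%N.

Definition dangcoef (b i j : nat) : R -> R :=
  match b, i, j with
  | 2, 3, 3 | 3, 2, 3 => fun th => (- (sin th ^+ 2)^-1)%R
  | 3, 3, 2 => fun th => (sin th ^+ 2 - cos th ^+ 2)%R
  | _, _, _ => fun=> 0%R
  end%N.

Lemma sin_chart_gt0 x : M x -> 0 < sin (x 0 ith).
Proof. by move=> /Mchart[_ ?]; exact: sin_gt0_pi. Qed.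

Lemma connE b x i j : M x -> conn (sphG K) b x i j =
  - (trcoef b i j (x 0 it) (x 0 ir) + angcoef b i j (x 0 ith)).
Proof.
move=> Mx; have [E7 E8 E9 E10] := K0 Mx; rewrite mxE /sphG.
by move: b i j; do 3![apply: ord4P]; rewrite /= ?E7 ?E8 ?E9 ?E10 ?mul0r ?addr0 ?add0r.
Qed.

Lemma smooth_trcoef b i j : smooth M (fun x : vec R => trcoef b i j (x 0 it) (x 0 ir)).
Proof.
have [sG _] := tfK.
have z : smooth M (fun _ : vec R => 0 : R) by move=> n; exact: Cn_cst.
case: b => [|[|b]] //; case: i => [|[|i]] //; case: j => [|[|j]] //.
- exact: (sG it it it).
- exact: (sG ir it it).
- exact: (sG it it ir).
- exact: (sG ir it ir).
- exact: (sG it it ir).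
- exact: (sG ir it ir).
- exact: (sG it ir ir).
- exact: (sG ir ir ir).
Qed.

(** Along coordinate directions the difference quotients are those of the one-variable restrictions,
    so the equalities hold for arbitrary [f]. *)
Lemma derive_tr (f : R -> R -> R) (x : vec R) :
  [/\ 'D_(delta_mx 0 it) (fun y : vec R => f (y 0 it) (y 0 ir)) x = pt f (x 0 it) (x 0 ir),
      'D_(delta_mx 0 ir) (fun y : vec R => f (y 0 it) (y 0 ir)) x = pr f (x 0 it) (x 0 ir),
      'D_(delta_mx 0 ith) (fun y : vec R => f (y 0 it) (y 0 ir)) x = 0 &
      'D_(delta_mx 0 iph) (fun y : vec R => f (y 0 it) (y 0 ir)) x = 0].
Proof.
have c (F : R -> R) : (forall h, F h = 0) -> lim (F @ 0^') = 0.
  move=> F0; have -> : F = fun=> 0 by rewrite funeqE.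
  exact: lim_cst.
split.
- rewrite /pt /derive1 /derive; set p := fun h : R => _; set q := fun h : R => _.
  suff -> : p = q by [].
  rewrite funeqE => h; rewrite /p /q /= !mxE /= mulr1 mulr0 add0r.
  by [].
- rewrite /pr /derive1 /derive; set p := fun h : R => _; set q := fun h : R => _.
  suff -> : p = q by [].
  by rewrite funeqE => h; rewrite /p /q /= !mxE /= mulr1 mulr0 add0r.
- by apply: c => h; rewrite /= !mxE /= mulr0 !add0r subrr scaler0.
- by apply: c => h; rewrite /= !mxE /= mulr0 !add0r subrr scaler0.
Qed.

Definition dtr (a : nat) (f : R -> R -> R) : R -> R -> R :=
  match a with 0 => pt f | 1 => pr f | _ => fun _ _ => 0%R end%N.

Lemma derive_dtr (a : 'I_4) (f : R -> R -> R) (x : vec R) :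
  'D_(delta_mx 0 a) (fun y : vec R => f (y 0 it) (y 0 ir)) x = dtr a f (x 0 it) (x 0 ir).
Proof. by have [Dt Dr Dth Dph] := derive_tr f x; move: a; apply: ord4P. Qed.

Lemma is_derive_angcoef b i j th : sin th != 0 ->
  is_derive th (1 : R) (angcoef b i j) (dangcoef b i j th).
Proof.
move=> s0; have ds := is_derive_sin th; have dc := is_derive_cos th.
have z : is_derive th (1 : R) (fun=> 0 : R) (0 : R) by exact: is_derive_lam_cst.
have dcot : is_derive th (1 : R) (fun th => cos th / sin th) (- (sin th ^+ 2)^-1).
  have dv : is_derive th (1 : R) (fun th => (sin th)^-1) (- (sin th) ^- 2 * cos th).
    apply: (is_derive_chain (h := fun z : R => z^-1) (f := @sin R)).
    have idd : derivable (@id R) (sin th) 1 by exact: derivable_id.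
    split; first exact: (@derivableV R R id (sin th) 1 s0 idd).
    have := @deriveV R R id (sin th) 1 s0 idd.
    by rewrite derive_id [_ *: 1]mulr1; exact.
  apply: is_derive_eq (is_derive_lam_mul dc dv) _.
  have c2 : cos th ^+ 2 = 1 - sin th ^+ 2 by rewrite -[X in X - _](cos2Dsin2 th) addrK.
  transitivity (- 1 - cos th ^+ 2 / sin th ^+ 2); first by field.
  by rewrite c2; field.
have dsc : is_derive th (1 : R) (fun th => - (sin th * cos th)) (sin th ^+ 2 - cos th ^+ 2).
  apply: is_derive_eq (is_derive_lam_opp (is_derive_lam_mul ds dc)) _.
  by ring.
by case: b => [|[|[|[|b]]]] //; case: i => [|[|[|[|i]]]] //; case: j => [|[|[|[|j]]]].
Qed.

Lemma is_derive_conn b x i j a : M x ->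
  is_derive x (delta_mx 0 a) (fun y => conn (sphG K) b y i j)
   (- (dtr a (trcoef b i j) (x 0 it) (x 0 ir) + (a == ith)%:R * dangcoef b i j (x 0 ith))).
Proof.
move=> Mx; have s0 := lt0r_neq0 (sin_chart_gt0 Mx).
have E y : M y -> - (trcoef b i j (y 0 it) (y 0 ir) + angcoef b i j (y 0 ith)) =
    conn (sphG K) b y i j by move=> My; rewrite connE.
apply: (eq_is_derive_open oM Mx E).
apply: is_derive_lam_opp; apply: is_derive_lam_add.
  have d := smooth_differentiable (smooth_trcoef b i j) Mx.
  by apply: is_derive_eq (diff_is_derive _ d) _; exact: derive_dtr.
have dth : is_derive x (delta_mx 0 a) (fun y : vec R => y 0 ith : R) (a == ith)%:R.
  have := is_derive_entry 0 ith x (delta_mx 0 a); rewrite mxE eqxx /=.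
  by rewrite eq_sym.
apply: is_derive_eq (is_derive_chain (is_derive_angcoef b i j s0) dth) _.
by rewrite mulrC.
Qed.

Lemma smooth_conn a i j : smooth M (fun x => conn (sphG K) a x i j).
Proof.
have [sG _] := tfK; move=> n.
apply: (eq_Cn oM) (CnN oM (sG j a i n)) => x _.
by rewrite mxE.
Qed.

Lemma mxdiff_conn a x : M x -> mxdiff (conn (sphG K) a) x.
Proof. by move=> Mx i j; exact: smooth_differentiable (smooth_conn a i j) Mx. Qed.

Definition curvmx (a b : 'I_4) : vec R -> 'M[R]_4 :=
  mxlie (delta_mx 0 a) (conn (sphG K) a) (delta_mx 0 b) (conn (sphG K) b).

Lemma curvmx_anti a b x : curvmx a b x = - curvmx b a x.
Proof.
have E (V : zmodType) (p q r s : V) : p - q + r - s = - (q - p + s - r).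
  by rewrite opprB opprD opprB addrA [r + _]addrC.
exact: E.
Qed.

Lemma curvmxE a b x i j : M x -> curvmx a b x i j =
  - (dtr a (trcoef b i j) (x 0 it) (x 0 ir) + (a == ith)%:R * dangcoef b i j (x 0 ith))
  + (dtr b (trcoef a i j) (x 0 it) (x 0 ir) + (b == ith)%:R * dangcoef a i j (x 0 ith))
  + \sum_(k < 4) (trcoef a i k (x 0 it) (x 0 ir) + angcoef a i k (x 0 ith)) *
           (trcoef b k j (x 0 it) (x 0 ir) + angcoef b k j (x 0 ith))
  - \sum_(k < 4) (trcoef b i k (x 0 it) (x 0 ir) + angcoef b i k (x 0 ith)) *
           (trcoef a k j (x 0 it) (x 0 ir) + angcoef a k j (x 0 ith)).
Proof.
move=> Mx; have d1 := is_derive_conn b i j a Mx; have d2 := is_derive_conn a i j b Mx.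
rewrite !mxE (is_deriveE d1) (is_deriveE d2) opprK.
by congr (_ + _ - _); apply: eq_bigr => k _; rewrite !connE // mulrNN.
Qed.

Lemma pt0 t r : pt (fun _ _ => 0 : R) t r = 0.
Proof. exact: derive1_cst. Qed.

Lemma pr0 t r : pr (fun _ _ => 0 : R) t r = 0.
Proof. exact: derive1_cst. Qed.

Definition trblock (t r : R) : 'M[R]_4 := \matrix_(i, j)
  match nat_of_ord i, nat_of_ord j with
  | 0, 0 => a1 K t r | 0, 1 => a3 K t r | 1, 0 => a2 K t r | 1, 1 => a4 K t r
  | _, _ => 0%R
  end%N.

(** For [s] equal to sin theta, a generator of the rotations of the tangent plane of the round
    sphere: it preserves w^2. *)
Definition rotation (s : R) : 'M[R]_4 := \matrix_(i, j)
  match nat_of_ord i, nat_of_ord j with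
  | 2, 3 => 1%R | 3, 2 => (- s ^+ 2)%R | _, _ => 0%R
  end%N.

Lemma ord4_eqE : [/\ (it == ith) = false, (ir == ith) = false, (ith == ith) = true &
  (iph == ith) = false].
Proof. by []. Qed.

Lemma curvmx_tr x : M x -> curvmx it ir x = trblock (x 0 it) (x 0 ir).
Proof.
move=> Mx; have [e0 e1 e2 e3] := ord4_eqE.
apply/matrixP; do 2![apply: ord4P]; rewrite curvmxE // !sum4 [RHS]mxE
  ?e0 ?e1 ?e2 ?e3 /= ?pt0 ?pr0 ?(mul0r, addr0, add0r, oppr0, mulr0, subr0) //
  /a1 /a2 /a3 /a4.
all: repeat match goal with
  | |- context [pt ?f ?t ?r] => generalize (pt f t r); intro
  | |- context [pr ?f ?t ?r] => generalize (pr f t r); intro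
  end; by ring.
Qed.

Lemma curvmx_ang x : M x -> curvmx ith iph x = rotation (sin (x 0 ith)).
Proof.
move=> Mx; have [e0 e1 e2 e3] := ord4_eqE.
have s0 := lt0r_neq0 (sin_chart_gt0 Mx).
apply/matrixP; do 2![apply: ord4P]; rewrite curvmxE // !sum4 [RHS]mxE
  ?e0 ?e1 ?e2 ?e3 /= ?(mul0r, addr0, add0r, oppr0, mulr0, subr0) //.
all: have := cos2Dsin2 (x 0 ith); move: s0; generalize (sin (x 0 ith)) (cos (x 0 ith)).
all: move=> s c s0 cs.
2: by field.
have c2 : c ^+ 2 = 1 - s ^+ 2 by rewrite -cs addrK.
by transitivity ((1 - c ^+ 2) / s ^+ 2); [field|rewrite c2; field].
Qed.

Lemma curvmx_mixed (a b : 'I_4) x : M x -> (a < 2)%N -> (2 <= b)%N -> curvmx a b x = 0.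
Proof.
move=> Mx a2 b2; have [e0 e1 e2 e3] := ord4_eqE.
move: a b a2 b2; do 2![apply: ord4P] => // _ _; apply/matrixP; do 2![apply: ord4P];
  by rewrite curvmxE // !sum4 [RHS]mxE ?e0 ?e1 ?e2 ?e3 /= ?pt0 ?pr0; ring.
Qed.

End CurvatureTable.

(** * Iterated brackets of the horizontal fields *)

Section Brackets.
Variables (R : realType) (M : set (vec R)) (A : set (tpt R)) (L : tpt R -> R)
  (K : sphcoef R).
Hypothesis HL : class5 M A L K.
Implicit Types N : vec R -> 'M[R]_4.
Let oM : open M := class5_open HL.
Let Mchart := class5_chart HL.
Let tfK : torsion_free_connection M (sphG K) := (class5_conn HL).1.
Let K0 := class5_k HL.

Lemma eq_lie_open (U : set (tpt R)) (X X' Y Y' : tpt R -> tpt R) u : open U -> U u ->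
  (forall v, U v -> X v = X' v) -> (forall v, U v -> Y v = Y' v) ->
  lie X Y u = lie X' Y' u.
Proof.
move=> oU Uu XX YY; rewrite /lie -(XX _ Uu) -(YY _ Uu).
by apply: (congr2 (fun a b => a - b)); exact: eq_derive_open oU Uu _.
Qed.

Definition split4 (N : 'M[R]_4) := forall i j : 'I_4, (i < 2)%N != (j < 2)%N -> N i j = 0.

Definition rotlike (s : R) (N : 'M[R]_4) :=
  [/\ N ith ith = 0, N iph iph = 0 & N iph ith = - s ^+ 2 * N ith iph].

(** The invariant carried through iterated brackets: no mixing between (t, r) and the angles, and an
    angular block that is a multiple of [rotation]. Smoothness allows the next bracket to be
    formed. *)
Definition adapted N := (forall i j, smooth M (fun x => N x i j)) /\
  forall x, M x -> split4 (N x) /\ rotlike (sin (x 0 ith)) (N x).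

Lemma mxlieE e N e' N' x i j : mxlie e N e' N' x i j =
  'D_e (fun y => N' y i j) x - 'D_e' (fun y => N y i j) x
  + \sum_k N x i k * N' x k j - \sum_k N' x i k * N x k j.
Proof. by rewrite !mxE. Qed.

Lemma smooth_mxlie e N e' N' : (forall i j, smooth M (fun x => N x i j)) ->
  (forall i j, smooth M (fun x => N' x i j)) ->
  forall i j, smooth M (fun x => mxlie e N e' N' x i j).
Proof.
move=> sN sN' i j n.
rewrite (_ : (fun x => _) = fun x =>
    'D_e (fun y => N' y i j) x + - 'D_e' (fun y => N y i j) x
  + \sum_k N x i k * N' x k j + - \sum_k N' x i k * N x k j); last first.
  by rewrite funeqE => x; rewrite mxlieE.
apply: CnD => //; [apply: CnD => //; [apply: CnD => //|]|].
- exact: smooth_derive.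
- by apply: CnN => //; exact: smooth_derive.
- by apply: Cn_sum => // k; apply: CnM => //; [exact: sN|exact: sN'].
- by apply: CnN => //; apply: Cn_sum => // k; apply: CnM => //; [exact: sN'|exact: sN].
Qed.

Lemma split4_mul (N N' : 'M[R]_4) : split4 N -> split4 N' -> split4 (N *m N').
Proof.
move=> sN sN' i j ij; rewrite mxE big1 // => k _.
have [ik|] := boolP ((i < 2)%N == (k < 2)%N).
  by rewrite sN' ?mulr0 // -(eqP ik).
by move=> /sN ->; rewrite mul0r.
Qed.

Lemma split4_conn a x : M x -> split4 (conn (sphG K) a x).
Proof.
move=> Mx i j; rewrite (connE K0) //; move: a i j.
by do 3![apply: ord4P] => //= _; rewrite addr0 oppr0.
Qed.

Lemma derive_entry0 e (f : vec R -> R) x : M x -> (forall y, M y -> f y = 0) -> 'D_e f x = 0.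
Proof.
by move=> Mx f0; rewrite (eq_derive_open e oM Mx f0); exact: (derive_cst (0 : R)).
Qed.

(** The bracket matrix is the covariant derivative of the endomorphism [N]. The quarter turn is
    parallel on the sphere and [rotation] is sin theta times it, so the derivative of a multiple of
    [rotation] is again a multiple. The block form persists because the connection does not mix the
    blocks. *)
Lemma adapted_mxlie a N : adapted N ->
  adapted (mxlie (delta_mx 0 a) (conn (sphG K) a) 0 N).
Proof.
move=> [sN bN]; split; first by apply: smooth_mxlie => // i j; exact: (smooth_conn oM tfK).
move=> x Mx; have [splN [N22 N33 N32]] := bN x Mx.
have s0 := lt0r_neq0 (sin_chart_gt0 Mchart Mx).
have E i j : mxlie (delta_mx 0 a) (conn (sphG K) a) 0 N x i j =
  'D_(delta_mx 0 a) (fun y => N y i j) x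
  + (conn (sphG K) a x *m N x) i j - (N x *m conn (sphG K) a x) i j.
  rewrite mxlieE (derive0 (fun y => conn (sphG K) a y i j) x : 'D_0 _ _ = 0) subr0.
  by rewrite !mxE.
split.
  move=> i j ij; rewrite E derive_entry0 //; last first.
    by move=> y My; have [splNy _] := bN y My; exact: splNy.
  rewrite !(split4_mul _ _ ij) ?subr0 ?addr0 //; exact: split4_conn.
have d22 : 'D_(delta_mx 0 a) (fun y => N y ith ith) x = 0.
  by apply: derive_entry0 => // y My; have [_ []] := bN y My.
have d33 : 'D_(delta_mx 0 a) (fun y => N y iph iph) x = 0.
  by apply: derive_entry0 => // y My; have [_ []] := bN y My.
(* In the direction theta the factor sin^2 contributes an extra term, which the Christoffel symbols
   of the sphere will cancel. *)
have d32 : 'D_(delta_mx 0 a) (fun y => N y iph ith) x =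
   - (sin (x 0 ith) ^+ 2 * 'D_(delta_mx 0 a) (fun y => N y ith iph) x
      + 2 * (a == ith)%:R * sin (x 0 ith) * cos (x 0 ith) * N x ith iph).
  have dth : is_derive x (delta_mx 0 a) (fun y : vec R => y 0 ith : R) (a == ith)%:R.
    have := is_derive_entry 0 ith x (delta_mx 0 a); rewrite mxE eqxx /=.
    by rewrite eq_sym.
  have ds := is_derive_chain (is_derive_sin (x 0 ith)) dth.
  have dN := diff_is_derive (delta_mx 0 a) (smooth_differentiable (sN ith iph) Mx).
  have dp := is_derive_lam_opp (is_derive_lam_mul (is_derive_lam_mul ds ds) dN).
  have e y : M y -> - (sin (y 0 ith) * sin (y 0 ith) * N y ith iph) = N y iph ith.
    by move=> My; have [_ [_ _ ->]] := bN y My; rewrite expr2 mulNr.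
  rewrite (is_deriveE (eq_is_derive_open oM Mx e dp)).
  by congr (- _); ring.
have z (i j : 'I_4) : (i < 2)%N != (j < 2)%N -> N x i j = 0 by exact: splN.
have [e0 e1 e2 e3] := ord4_eqE.
have [n En] : exists n, N x ith iph = n by exists (N x ith iph).
split; rewrite !E ?d22 ?d33 ?d32 !mxE !sum4 !(connE K0) // ?N22 ?N33 ?N32
  ?(z it ith) ?(z it iph) ?(z ir ith) ?(z ir iph) ?(z ith it) ?(z ith ir)
  ?(z iph it) ?(z iph ir) //.
all: rewrite ?En; generalize ('D_(delta_mx 0 a) (fun y => N y ith iph) x); move=> d.
all: move: a {E d22 d33 d32}; apply: ord4P; rewrite ?e0 ?e1 ?e2 ?e3 /=.
all: move: s0; generalize (sin (x 0 ith)) (cos (x 0 ith)); move=> s c s0.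
all: by field.
Qed.

Lemma adapted_curvmx a b : adapted (curvmx K a b).
Proof.
split.
  by apply: smooth_mxlie => i j; exact: (smooth_conn oM tfK).
move=> x Mx.
have adN (N : 'M[R]_4) : split4 N /\ rotlike (sin (x 0 ith)) N ->
    split4 (- N) /\ rotlike (sin (x 0 ith)) (- N).
  move=> [sN [n22 n33 n32]]; split; first by move=> i j /sN; rewrite mxE => ->; rewrite oppr0.
  by split; rewrite !mxE ?n22 ?n33 ?oppr0 // n32 mulrN.
have ad0 : split4 (0 : 'M[R]_4) /\ rotlike (sin (x 0 ith)) (0 : 'M[R]_4).
  by split; [move=> i j _; rewrite mxE|split; rewrite !mxE // mulr0].
have adtr : split4 (trblock K (x 0 it) (x 0 ir)) /\
    rotlike (sin (x 0 ith)) (trblock K (x 0 it) (x 0 ir)).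
  by split; [do 2![apply: ord4P] => //= _; rewrite mxE|split; rewrite !mxE //= mulr0].
have adrot : split4 (rotation (sin (x 0 ith))) /\
    rotlike (sin (x 0 ith)) (rotation (sin (x 0 ith))).
  by split; [do 2![apply: ord4P] => //= _; rewrite mxE|split; rewrite !mxE //= mulr1].
have adsame c : split4 (curvmx K c c x) /\ rotlike (sin (x 0 ith)) (curvmx K c c x).
  suff -> : curvmx K c c x = 0 by [].
  by rewrite /curvmx /mxlie subrr add0r subrr.
have admix (c d : 'I_4) : (c < 2)%N -> (2 <= d)%N ->
    (split4 (curvmx K c d x) /\ rotlike (sin (x 0 ith)) (curvmx K c d x)) /\
    (split4 (curvmx K d c x) /\ rotlike (sin (x 0 ith)) (curvmx K d c x)).
  move=> c2 d2; rewrite [curvmx K d c x]curvmx_anti.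
  by have -> : curvmx K c d x = 0; [exact: (curvmx_mixed oM Mchart tfK K0)|split=> //; exact: adN].
move: a b; do 2![apply: ord4P] => //; try exact: (admix _ _ _ _).1; try exact: (admix _ _ _ _).2.
- by rewrite (curvmx_tr oM Mchart tfK K0).
- by rewrite curvmx_anti (curvmx_tr oM Mchart tfK K0) //; exact: adN.
- by rewrite (curvmx_ang oM Mchart tfK K0).
- by rewrite curvmx_anti (curvmx_ang oM Mchart tfK K0) //; exact: adN.
Qed.

Lemma fibre_base u : A u -> M u.1.
Proof. by have [[_ slA _ _] _ _ _] := class5_finsler HL => /slA[]. Qed.

Lemma adapted_mxdiff N : adapted N -> forall u, A u -> mxdiff N u.1.
Proof.
by move=> [sN _] u /fibre_base Mu i j; exact: smooth_differentiable (sN i j) Mu.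
Qed.

Lemma annihilates_conn a : annihilates A L (vfield (delta_mx 0 a) (conn (sphG K) a)).
Proof.
rewrite -delta_vfield; exact: canonical_annihilates (class5_finsler HL) (class5_conn HL).
Qed.

Lemma mxdiff_conn_fibre a u : A u -> mxdiff (conn (sphG K) a) u.1.
Proof. by move=> /fibre_base Mu; exact: (mxdiff_conn oM tfK). Qed.

Lemma annihilates_curvmx a b : annihilates A L (vfield 0 (curvmx K a b)).
Proof.
have [[oA _ _ _] sL _ _] := class5_finsler HL.
by apply: (annihilates_lie oA sL); [exact: mxdiff_conn_fibre|exact: mxdiff_conn_fibre|
  exact: annihilates_conn|exact: annihilates_conn].
Qed.

Lemma lie_delta a b u : M u.1 ->
  lie (delta (sphG K) a) (delta (sphG K) b) u = vfield 0 (curvmx K a b) u.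
Proof.
by move=> Mu; rewrite !delta_vfield lie_vfield //; exact: (mxdiff_conn oM tfK).
Qed.

(** [X] is represented on all vectors over the open set [M], not at one point only, so that the next
    bracket can differentiate the identity. *)
Lemma hbracketP X : hbracket (sphG K) X -> (exists a, X = delta (sphG K) a) \/
  exists N, [/\ adapted N, (forall u, M u.1 -> X u = vfield 0 N u) &
    annihilates A L (vfield 0 N)].
Proof.
have [[oA _ _ _] sL _ _] := class5_finsler HL.
elim=> [a|a Y _ [[b ->]|[N [aN YN kN]]]]; [by left; exists a| |]; right.
- exists (curvmx K a b); split; [exact: adapted_curvmx|exact: lie_delta|].
  exact: annihilates_curvmx.
- exists (mxlie (delta_mx 0 a) (conn (sphG K) a) 0 N); split.
  + exact: adapted_mxlie.
  + move=> u Mu; rewrite (eq_lie_open (open_over oM) Mu (fun v _ => erefl) YN).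
    rewrite delta_vfield lie_vfield //; first exact: (mxdiff_conn oM tfK).
    by move=> i j; have [sN _] := aN; exact: smooth_differentiable (sN i j) Mu.
  + apply: (annihilates_lie oA sL) => //; [exact: mxdiff_conn_fibre| |].
      exact: adapted_mxdiff.
    exact: annihilates_conn.
Qed.

End Brackets.

(** * Curvature determinant, Ricci tensor and dimension of the vertical part *)

Section CurvatureConsequences.
Variables (R : realType) (M : set (vec R)) (A : set (tpt R)) (L : tpt R -> R)
  (K : sphcoef R).
Hypothesis HL : class5 M A L K.
Let oM : open M := class5_open HL.
Let Mchart := class5_chart HL.
Let tfK : torsion_free_connection M (sphG K) := (class5_conn HL).1.
Let K0 := class5_k HL.

Lemma killing_trblock x : M x -> killing A L x (trblock K (x 0 it) (x 0 ir)).
Proof.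
move=> Mx y Axy; have := annihilates_curvmx HL it ir Axy.
by rewrite /vfield /= (curvmx_tr oM Mchart tfK K0 Mx).
Qed.

Lemma killing_rotation x : M x -> killing A L x (rotation (sin (x 0 ith))).
Proof.
move=> Mx y Axy; have := annihilates_curvmx HL ith iph Axy.
by rewrite /vfield /= (curvmx_ang oM Mchart tfK K0 Mx).
Qed.

Lemma ord2P (P : 'I_4 -> Prop) : P it -> P ir -> forall i : 'I_4, (i < 2)%N -> P i.
Proof. by move=> Pt Pr; apply: ord4P. Qed.

Lemma trblock0 t r (i j : 'I_4) : (2 <= i)%N || (2 <= j)%N -> trblock K t r i j = 0.
Proof. by rewrite mxE; move: i j; do 2![apply: ord4P]. Qed.

Lemma trblock_rank1 t r (i j k l : 'I_4) :
  a1 K t r * a4 K t r - a2 K t r * a3 K t r = 0 ->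
  trblock K t r i j * trblock K t r k l = trblock K t r k j * trblock K t r i l.
Proof.
move=> /eqP; rewrite subr_eq0 => /eqP det0.
have [i2|i2] := leqP 2 i; first by rewrite !(@trblock0 t r i _) ?i2 // mul0r mulr0.
have [k2|k2] := leqP 2 k; first by rewrite !(@trblock0 t r k _) ?k2 // mul0r mulr0.
have [j2|j2] := leqP 2 j.
  by rewrite (@trblock0 t r _ j) ?j2 ?orbT // (@trblock0 t r _ j) ?j2 ?orbT // !mul0r.
have [l2|l2] := leqP 2 l.
  by rewrite (@trblock0 t r _ l) ?l2 ?orbT // (@trblock0 t r _ l) ?l2 ?orbT // !mulr0.
rewrite !mxE; move: i i2 k k2 j j2 l l2; do 4![apply: ord2P] => /=.
all: move: det0; generalize (a1 K t r) (a2 K t r) (a3 K t r) (a4 K t r).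
all: by move=> b1 b2 b3 b4 E; first [ring | ring: E].
Qed.

(** A singular block satisfies the rank-one relations, so [killing_rank1] makes all its entries
    vanish, although the bracket is nonzero somewhere on the fibre. *)
Lemma curvature_det x : M x ->
  a1 K (x 0 it) (x 0 ir) * a4 K (x 0 it) (x 0 ir)
    - a2 K (x 0 it) (x 0 ir) * a3 K (x 0 it) (x 0 ir) != 0.
Proof.
set t := x 0 it; set r := x 0 ir => Mx; apply/negP => /eqP det0.
have [y [Axy]] := class5_curv HL Mx; apply.
rewrite (lie_delta HL) // /vfield /= (curvmx_tr oM Mchart tfK K0 Mx) -/t -/r.
have kN := killing_trblock Mx; rewrite -/t -/r in kN.
suff -> : trblock K t r = 0 by rewrite mulmx0.
apply/matrixP => i j; rewrite [RHS]mxE.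
apply: (killing_rank1 (class5_finsler HL) Axy kN) => k l.
exact: trblock_rank1.
Qed.

Lemma curvature_a5 x : M x -> a5 K (x 0 it) (x 0 ir) = 0.
Proof.
move=> Mx; have [_ D8 _ _] := derive_tr (k8 K) x; have [D9 _ _ _] := derive_tr (k9 K) x.
rewrite /a5 -D8 -D9 !(derive_entry0 HL) ?subrr // => y My.
  by have [] := K0 My.
by have [] := K0 My.
Qed.

(** The curvature components are linear in the fibre variable, so the fibre derivative of index [b]
    reads off row [b]. *)
Lemma ricciE b c u : M u.1 -> ricci (sphG K) b c u = \sum_a curvmx K c a u.1 b a.
Proof.
move=> Mu; apply: eq_bigr => a _.
have E v : M v.1 -> (v.2 *m curvmx K c a v.1) 0 a = curv (sphG K) a c a v.
  by move=> Mv; rewrite /curv (lie_delta HL).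
have [sN _] := adapted_curvmx HL c a.
have dN : mxdiff (curvmx K c a) u.1.
  by move=> i j; exact: smooth_differentiable (sN i j) Mu.
have i1 := is_derive_vfield_coord (0, delta_mx 0 b) a dN.
have i2 := eq_is_derive_open (open_over oM) Mu E i1.
rewrite /dy (is_deriveE i2) /=.
have -> : dmx 0 (curvmx K c a) u.1 = 0.
  by apply/matrixP => i j; rewrite !mxE derive0.
by rewrite mulmx0 addr0 -rowE mxE.
Qed.

Lemma curvmx_table (a b : 'I_4) x : M x -> curvmx K a b x =
  match nat_of_ord a, nat_of_ord b with
  | 0%N, 1%N => trblock K (x 0 it) (x 0 ir)
  | 1%N, 0%N => - trblock K (x 0 it) (x 0 ir)
  | 2%N, 3%N => rotation (sin (x 0 ith))
  | 3%N, 2%N => - rotation (sin (x 0 ith))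
  | _, _ => 0
  end.
Proof.
move=> Mx.
have same c : curvmx K c c x = 0 by rewrite /curvmx /mxlie subrr add0r subrr.
have mixed (c d : 'I_4) : (c < 2)%N -> (2 <= d)%N -> curvmx K c d x = 0.
  by move=> c2 d2; exact: (curvmx_mixed oM Mchart tfK K0).
have mixed' (c d : 'I_4) : (c < 2)%N -> (2 <= d)%N -> curvmx K d c x = 0.
  by move=> c2 d2; rewrite curvmx_anti mixed // oppr0.
move: a b; do 2![apply: ord4P] => /=.
1,6,11,16: exact: same.
2,3,5,6: exact: mixed.
3,4,6,7: exact: mixed'.
- exact: (curvmx_tr oM Mchart tfK K0).
- by rewrite curvmx_anti (curvmx_tr oM Mchart tfK K0).
- exact: (curvmx_ang oM Mchart tfK K0).
- by rewrite curvmx_anti (curvmx_ang oM Mchart tfK K0).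
Qed.

(** Only the pair (t, r) contributes: R_rt is [a4], and R_tr is [- a1] because [curvmx] changes sign
    when its indices are exchanged. *)
Lemma ricci_antisym u : M u.1 -> let t := u.1 0 it in let r := u.1 0 ir in
  ricci (sphG K) ir it u - ricci (sphG K) it ir u = a1 K t r + a4 K t r.
Proof.
move=> Mu t r; rewrite !ricciE // !sum4 !curvmx_table //= !mxE /=.
by rewrite !(addr0, add0r) opprK addrC.
Qed.

Lemma ricci_symP u : M u.1 -> let t := u.1 0 it in let r := u.1 0 ir in
  (forall b c, ricci (sphG K) b c u = ricci (sphG K) c b u) <-> a1 K t r + a4 K t r = 0.
Proof.
move=> Mu t r; rewrite -(ricci_antisym Mu); split=> [-> | ]; first by rewrite subrr.
move=> /eqP; rewrite subr_eq0 => /eqP E.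
move=> b c; rewrite !ricciE // in E *; move: b c; do 2![apply: ord4P].
1,6,11,16: exact: erefl.
1: exact: esym E.
3: exact: E.
(* In the remaining entries both sides are zero: the curvature does not mix the blocks and
   [rotation] has zero diagonal. *)
all: rewrite !sum4 !curvmx_table //= !mxE /=.
all: by rewrite ?(addr0, add0r, oppr0).
Qed.

Lemma vfield_block_span N u : A u -> adapted M N -> annihilates A L (vfield 0 N) ->
  u.2 *m N u.1 \in (<[(u.2 *m trblock K (u.1 0 it) (u.1 0 ir))%R]> +
                    <[(u.2 *m rotation (sin (u.1 0 ith)))%R]>)%VS.
Proof.
case: u => x y /= Axy [_ bN] kN; have Mx := fibre_base HL Axy.
have [splN [N22 N33 N32]] := bN x Mx.
set B := trblock K _ _; set J := rotation _.
(* Subtracting this multiple of the rotation, itself a symmetry of [L], leaves a symmetry acting on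
   (tdot, rdot) only, to which [killing_minor] applies together with [B]. *)
pose N' := N x - N x ith iph *: J.
have -> : y *m N x = y *m N' + N x ith iph *: (y *m J).
  by rewrite /N' mulmxBr -scalemxAr subrK.
apply: memv_add; last by rewrite memvZ // memv_line.
have kN' : killing A L x N'.
  move=> z Axz; have dL : differentiable L (x, z).
    by have [[oA _ _ _] sL _ _] := class5_finsler HL; exact: smooth_differentiable sL Axz.
  have -> : (0, z *m N') = (0, z *m N x) + - N x ith iph *: (0, z *m J) :> tpt R.
    congr (_, _); first by rewrite /= scaler0 addr0.
    by rewrite /N' mulmxBr scaleNr -scalemxAr.
  rewrite deriveDdir // deriveZdir // (killing_rotation Mx Axz) scaler0 addr0.
  exact: (kN (x, z) Axz).
have z (i j : 'I_4) : (i < 2)%N != (j < 2)%N -> N x i j = 0 by exact: splN.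
have N'0 k m : k != it -> k != ir -> B m k = 0 /\ N' m k = 0.
  by move: m k; do 2![apply: ord4P] => //= _ _; rewrite !mxE /=; split=> //;
    rewrite ?N22 ?N33 ?N32 ?(z it ith) ?(z it iph) ?(z ir ith) ?(z ir iph) //; ring.
have minor := killing_minor (class5_finsler HL) Axy (isT : it != ir)
  (killing_trblock Mx) kN' N'0 y.
have yN'0 k : k != it -> k != ir -> (y *m N') 0 k = 0 /\ (y *m B) 0 k = 0.
  move=> kt kr; rewrite !mxE !big1 // => m _; have [E1 E2] := N'0 k m kt kr.
    by rewrite E1 mulr0.
  by rewrite E2 mulr0.
move: minor; rewrite -/B => minor.
have [E|Bt] := eqVneq ((y *m B) 0 it) 0; last first.
  suff -> : y *m N' = ((y *m N') 0 it / (y *m B) 0 it) *: (y *m B).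
    by rewrite memvZ // memv_line.
  apply/rowP => k; rewrite [RHS]mxE.
  have [->|kt] := eqVneq k it; first by rewrite divfK.
  have [->|kr] := eqVneq k ir; last by have [-> ->] := yN'0 k kt kr; rewrite mulr0.
  apply: (mulfI Bt); rewrite mulrA [_ * (_ / _)]mulrCA mulfV // mulr1.
  by move/eqP: minor; rewrite subr_eq0 => /eqP ->; rewrite mulrC.
have [E'|Br] := eqVneq ((y *m B) 0 ir) 0; last first.
  suff -> : y *m N' = ((y *m N') 0 ir / (y *m B) 0 ir) *: (y *m B).
    by rewrite memvZ // memv_line.
  apply/rowP => k; rewrite [RHS]mxE.
  have [->|kr] := eqVneq k ir; first by rewrite divfK.
  have [->|kt] := eqVneq k it; last by have [-> ->] := yN'0 k kt kr; rewrite mulr0.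
  apply: (mulfI Br); rewrite mulrA [_ * (_ / _)]mulrCA mulfV // mulr1.
  by move/eqP: minor; rewrite subr_eq0 => /eqP <-; rewrite mulrC.
(* In the remaining case [y *m B = 0], the determinant forces the (t, r) components of [y] to
   vanish, hence also [y *m N']. *)
have det := curvature_det Mx.
set b1 := a1 K _ _ in det; set b2 := a2 K _ _ in det.
set b3 := a3 K _ _ in det; set b4 := a4 K _ _ in det.
have N'low : N' ith it = 0 /\ N' ith ir = 0 /\ N' iph it = 0 /\ N' iph ir = 0.
  by rewrite !mxE /= (z ith it) // (z ith ir) // (z iph it) // (z iph ir) // mulr0 subr0.
move: E E'; rewrite !mxE !sum4 !mxE /= !mulr0 !addr0 => E E'.
have yt : y 0 it = 0.
  apply: (mulfI det); rewrite mulr0.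
  transitivity ((y 0 it * b1 + y 0 ir * b2) * b4 - (y 0 it * b3 + y 0 ir * b4) * b2).
    by ring.
  by rewrite E E' !mul0r subr0.
have yr : y 0 ir = 0.
  apply: (mulfI det); rewrite mulr0.
  transitivity ((y 0 it * b3 + y 0 ir * b4) * b1 - (y 0 it * b1 + y 0 ir * b2) * b3).
    by ring.
  by rewrite E E' !mul0r subr0.
suff -> : y *m N' = 0 by exact: mem0v.
have [l1 [l2 [l3 l4]]] := N'low.
apply/rowP => k; rewrite [RHS]mxE.
have [->|kt] := eqVneq k it; first by rewrite mxE sum4 yt yr l1 l3 !(mul0r, mulr0, addr0).
have [->|kr] := eqVneq k ir; first by rewrite mxE sum4 yt yr l2 l4 !(mul0r, mulr0, addr0).
by have [] := yN'0 k kt kr.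
Qed.

Lemma vertical_part_dim u : A u -> dim_le (vertical_part (sphG K) u) 2.
Proof.
move=> Au; have Mu := fibre_base HL Au.
pose B := trblock K (u.1 0 it) (u.1 0 ir); pose J := rotation (sin (u.1 0 ith)).
exists (<[(u.2 *m B : vec R)]> + <[(u.2 *m J : vec R)]>)%VS; split; last first.
  apply: leq_trans (dimv_add_leqif _ _) _.
  by rewrite !dim_vline; case: (_ != 0); case: (_ != 0).
move=> v; split=> [[s [Hs vs]]|].
  (* Projection to the vertical part along the horizontal fields: it is linear, fixes vertical
     vectors and kills every [delta (sphG K) a u], so horizontal generators drop out. *)
  pose phi (z : tpt R) := z.2 - \sum_a z.1 0 a *: (delta (sphG K) a u).2.
  have phiD z z' : phi (z + z') = phi z + phi z'.
    rewrite /phi /= -[RHS]addrACA -opprD -big_split /=; congr (_ - _).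
    by apply: eq_bigr => a _; rewrite mxE scalerDl.
  have phiZ c z : phi (c *: z) = c *: phi z.
    rewrite /phi /= scalerBr scaler_sumr; congr (_ - _).
    by apply: eq_bigr => a _; rewrite mxE scalerA.
  have -> : v = phi (0, v).
    by rewrite /phi /= big1 ?subr0 // => a _; rewrite mxE scale0r.
  rewrite (coord_span (X := in_tuple s) vs).
  apply: (big_ind (fun z => phi z \in (<[(u.2 *m B : vec R)]> + <[(u.2 *m J : vec R)]>)%VS)).
  - by rewrite /phi /= big1 ?subr0 ?mem0v // => a _; rewrite mxE scale0r.
  - by move=> z z' Hz Hz'; rewrite phiD memvD.
  move=> i _; rewrite phiZ memvZ //.
  have /Hs[X [hX ->]] : (in_tuple s)`_i \in s by rewrite mem_nth.
  have [[a ->]|[N [aN XN kN]]] := hbracketP HL hX.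
    rewrite /phi (bigD1 a) //= mxE !eqxx scale1r big1 ?addr0 ?subrr ?mem0v // => b ba.
    by rewrite mxE (negbTE ba) andbF scale0r.
  rewrite XN // /phi /vfield big1 /= ?subr0; last by move=> a _; rewrite mxE scale0r.
  exact: vfield_block_span.
move=> /memv_addP[v1 /vlineP[c1 ->] [v2 /vlineP[c2 ->] ->]].
(* Conversely, the two spanning vectors are themselves brackets, so the space equals the vertical
   part. *)
exists [:: lie (delta (sphG K) it) (delta (sphG K) ir) u;
           lie (delta (sphG K) ith) (delta (sphG K) iph) u]; split.
  move=> z; rewrite !inE => /orP[]/eqP ->.
    by exists (lie (delta (sphG K) it) (delta (sphG K) ir)); split=> //; do 2!constructor.
  by exists (lie (delta (sphG K) ith) (delta (sphG K) iph)); split=> //; do 2!constructor.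
rewrite !(lie_delta HL) // /vfield !curvmx_table //=.
have -> : (0, c1 *: (u.2 *m B) + c2 *: (u.2 *m J)) =
    c1 *: (0, u.2 *m B) + c2 *: (0, u.2 *m J) :> tpt R.
  by congr (_, _); rewrite /= !scaler0 addr0.
by apply: memvD; apply: memvZ; apply: memv_span; rewrite !inE eqxx ?orbT.
Qed.

End CurvatureConsequences.

(** * Affinely equivalent metrics *)

Section QuadraticMetrics.
Variables (R : realType) (M : set (vec R)).
Hypothesis oM : open M.
Variable S : vec R -> 'M[R]_4.
Hypothesis smS : forall i j, smooth M (fun x => S x i j).

Definition qmetric (T : vec R -> 'M[R]_4) (u : tpt R) : R := qform (T u.1) u.2.

Lemma qformE (N : 'M[R]_4) y : qform N y = (y *m N *m y^T) 0 0.
Proof.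
rewrite mxE /qform; under [RHS]eq_bigr do rewrite !mxE mulr_suml.
rewrite exchange_big /=; apply: eq_bigr => i _; apply: eq_bigr => j _.
by rewrite [y 0 j * _]mulrC.
Qed.

Lemma qformD (N N' : 'M[R]_4) y : qform (N + N') y = qform N y + qform N' y.
Proof. by rewrite !qformE mulmxDr mulmxDl mxE. Qed.

Lemma qformZ c (N : 'M[R]_4) y : qform (c *: N) y = c * qform N y.
Proof. by rewrite !qformE -scalemxAr -scalemxAl mxE. Qed.

Lemma smooth_qmetric : smooth [set u : tpt R | M u.1] (qmetric S).
Proof.
move=> n; have oU := open_over oM.
apply: Cn_sum => // i; apply: Cn_sum => // j.
apply: CnM => //; last exact: Cn_fiber.
apply: CnM => //; last exact: Cn_fiber.
exact: (@Cn_fst R (vec R) (vec R) R n M (fun x => S x i j) (smS i j n)).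
Qed.

Lemma is_derive_qmetric u v : M u.1 -> is_derive u v (qmetric S)
  (qform (dmx v.1 S u.1) u.2 +
    \sum_i \sum_j S u.1 i j * (v.2 0 i * u.2 0 j + u.2 0 i * v.2 0 j)).
Proof.
move=> Mu.
have H i j : is_derive u v (fun w : tpt R => S w.1 i j * w.2 0 i * w.2 0 j)
   (dmx v.1 S u.1 i j * u.2 0 i * u.2 0 j +
    S u.1 i j * (v.2 0 i * u.2 0 j + u.2 0 i * v.2 0 j)).
  have d1 := diff_is_derive v.1 (smooth_differentiable (smS i j) Mu).
  have d2 : is_derive u v (fun w : tpt R => S w.1 i j) ('D_(v.1) (fun x => S x i j) u.1).
    exact: (is_derive_fst (f := fun x => S x i j)).
  apply: is_derive_eq (is_derive_lam_mul (is_derive_lam_mul d2 (is_derive_fiber i u v))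
    (is_derive_fiber j u v)) _.
  rewrite mxE; generalize ('D_(v.1) (fun x => S x i j) u.1) => d; ring.
apply: is_derive_eq (is_derive_lam_sum (fun i => is_derive_lam_sum (H i))) _.
rewrite /qform -big_split /=; apply: eq_bigr => i _.
by rewrite -big_split.
Qed.

(* Covariant derivative of the symmetric tensor S; conn already carries the minus
   sign of the Christoffel symbols. *)
Definition nabla (G : coefs R) a x : 'M[R]_4 :=
  dmx (delta_mx 0 a) S x + conn G a x *m S x + S x *m (conn G a x)^T.

Lemma derive_delta_qmetric G a u : M u.1 ->
  'D_(delta G a u) (qmetric S) u = qform (nabla G a u.1) u.2.
Proof.
move=> Mu; rewrite delta_vfield (is_deriveE (is_derive_qmetric _ Mu)) /=.
rewrite /nabla !qformD -addrA; congr (_ + _).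
set C := conn G a u.1; set y := u.2; set T := S u.1.
have -> : \sum_i \sum_j T i j * ((y *m C) 0 i * y 0 j + y 0 i * (y *m C) 0 j) =
   ((y *m C) *m T *m y^T) 0 0 + (y *m T *m (y *m C)^T) 0 0.
  rewrite !mxE -big_split exchange_big /=; apply: eq_bigr => j _.
  rewrite ![((_ *m T)) 0 j]mxE ![_^T _ _]mxE !mulr_suml -big_split /=.
  by apply: eq_bigr => i _; ring.
by rewrite !qformE trmx_mul !mulmxA.
Qed.

Lemma qmetric_homogeneous x y c : qmetric S (x, c *: y) = c ^+ 2 * qmetric S (x, y).
Proof.
rewrite /qmetric /qform mulr_sumr; apply: eq_bigr => i _; rewrite mulr_sumr.
by apply: eq_bigr => j _; rewrite /= !mxE; ring.
Qed.

Hypothesis symS : forall x i j, M x -> S x i j = S x j i.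

Lemma fundamental_tensor_qmetric u : M u.1 -> fundamental_tensor (qmetric S) u = S u.1.
Proof.
move=> Mu; have oU := open_over oM.
have E1 b (v : tpt R) : M v.1 -> 2 * \sum_j S v.1 b j * v.2 0 j = dy b (qmetric S) v.
  move=> Mv; rewrite /dy (is_deriveE (is_derive_qmetric _ Mv)) /=.
  have -> : dmx 0 S v.1 = 0 by apply/matrixP => i j; rewrite !mxE derive0.
  have -> : qform (0 : 'M[R]_4) v.2 = 0 by rewrite qformE mulmx0 mul0mx mxE.
  rewrite add0r mulr2n mulrDl mul1r; under [RHS]eq_bigr do under eq_bigr do rewrite mulrDr.
  under [RHS]eq_bigr do rewrite big_split /=.
  rewrite big_split /=; congr (_ + _).
    rewrite [RHS](bigD1 b) //= [X in _ = _ + X]big1 ?addr0 => [|i ib].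
      by apply: eq_bigr => j _; rewrite mxE !eqxx mul1r.
    by rewrite big1 // => j _; rewrite mxE (negbTE ib) andbF mul0r mulr0.
  apply: eq_bigr => i _; rewrite [RHS](bigD1 b) //= big1 ?addr0 => [|j jb].
    by rewrite mxE !eqxx mulr1 symS.
  by rewrite mxE (negbTE jb) andbF !mulr0.
apply/matrixP => a b; rewrite mxE.
have i2 : is_derive u (0, delta_mx 0 a) (fun v : tpt R => 2 * \sum_j S v.1 b j * v.2 0 j)
    (2 * S u.1 b a).
  have H j : is_derive u (0, delta_mx 0 a) (fun v : tpt R => S v.1 b j * v.2 0 j)
     (S u.1 b j * (delta_mx 0 a : vec R) 0 j).
    have d2 := @is_derive_fst R _ (vec R) R (fun x => S x b j) (0, delta_mx 0 a) u 0
      (is_derive0 _ _).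
    apply: is_derive_eq (is_derive_lam_mul d2 (is_derive_fiber j u (0, delta_mx 0 a))) _.
    by rewrite mul0r add0r.
  have i1 := is_derive_lam_mul (is_derive_lam_cst (2 : R) u (0, delta_mx 0 a))
     (is_derive_lam_sum H).
  apply: is_derive_eq i1 _; rewrite mul0r add0r; congr (_ * _).
  rewrite (bigD1 a) //= mxE !eqxx mulr1 big1 ?addr0 // => j ja.
  by rewrite mxE (negbTE ja) andbF mulr0.
rewrite /dy (is_deriveE (eq_is_derive_open oU Mu (E1 b) i2)).
by rewrite mulrA mulVf // mul1r symS.
Qed.

Hypothesis unitS : forall x, M x -> S x \in unitmx.

Lemma conic_slit : conic_subbundle M (slit M).
Proof.
split=> //.
- rewrite (_ : slit M = [set u | M u.1] `&` [set u | u.2 != 0]).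
    apply: openI; first exact: open_over.
    rewrite openE => u /= u0.
    have n0 : nbhs u.2 [set y : vec R | y != 0].
      apply/nbhs_ballP; exists `|u.2| => /=; first by rewrite normr_gt0.
      by move=> y; rewrite -ball_normE /=; apply: contraTneq => ->; rewrite subr0 ltxx.
    exact: (@cvg_snd _ _ (nbhs u.1) (nbhs u.2) _ _ n0).
  by [].
- move=> x Mx; exists (delta_mx 0 it); split=> //=.
  by apply/eqP => /rowP/(_ it); rewrite !mxE !eqxx /= => /eqP; rewrite oner_eq0.
- move=> x y c c0 [Mx y0]; split=> //=.
  by rewrite scaler_eq0 negb_or gt_eqF.
Qed.

Lemma finsler_qmetric : finsler M (slit M) (qmetric S).
Proof.
split; first exact: conic_slit.
- move=> n; apply: (subset_Cn _ (smooth_qmetric n)); by move=> u [].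
- by move=> x y c _ _; exact: qmetric_homogeneous.
- by move=> u [Mu _]; rewrite fundamental_tensor_qmetric //; exact: unitS.
Qed.

Lemma pseudo_riemannian_qmetric : pseudo_riemannian M (slit M) (qmetric S).
Proof. by split; [exact: finsler_qmetric|exists S]. Qed.

End QuadraticMetrics.

Lemma unitmx_inj (R : fieldType) n (N : 'M[R]_n) :
  (forall v : 'rV[R]_n, v *m N = 0 -> v = 0) -> N \in unitmx.
Proof.
move=> H; rewrite -row_free_unit -kermx_eq0; apply/rowV0P => v /sub_kermxP.
exact: H.
Qed.

(** * The two blocks of the metric: Q and w^2 *)

Section BlockMetric.
Variables (R : realType) (M : set (vec R)) (A : set (tpt R)) (L : tpt R -> R)
  (K : sphcoef R).
Hypothesis HL : class5 M A L K.
Let oM : open M := class5_open HL.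
Let Mchart := class5_chart HL.
Let tfK : torsion_free_connection M (sphG K) := (class5_conn HL).1.
Let K0 := class5_k HL.

(** The coefficients of Q. When [a1 + a4 = 0], the field [y *m trblock] is half the Hamiltonian
    field of Q in the (tdot, rdot) plane, so [delta_t, delta_r] annihilates Q. *)
Definition metcoef (i j : nat) : R -> R -> R :=
  match i, j with
  | 0%N, 0%N => fun t r => - a3 K t r
  | 0%N, 1%N | 1%N, 0%N => a1 K
  | 1%N, 1%N => a2 K
  | _, _ => fun _ _ => 0
  end.

Definition trmetric (x : vec R) : 'M[R]_4 := \matrix_(i, j) metcoef i j (x 0 it) (x 0 ir).

Definition angmetric (x : vec R) : 'M[R]_4 := \matrix_(i, j)
  match nat_of_ord i, nat_of_ord j with
  | 2%N, 2%N => 1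
  | 3%N, 3%N => sin (x 0 ith) ^+ 2
  | _, _ => 0
  end.

Lemma trmetricE u : qmetric trmetric u = Qform K u.
Proof.
rewrite /qmetric /qform /Qform !sum4 !mxE /=; ring.
Qed.

Lemma angmetricE u : qmetric angmetric u =
  u.2 0 ith ^+ 2 + u.2 0 iph ^+ 2 * sin (u.1 0 ith) ^+ 2.
Proof. rewrite /qmetric /qform !sum4 !mxE /=; ring. Qed.

Lemma angmetric_ge0 u : 0 <= qmetric angmetric u.
Proof.
by rewrite angmetricE; apply: addr_ge0; [|apply: mulr_ge0]; exact: sqr_ge0.
Qed.

Lemma wfunE u : wfun u = Num.sqrt (qmetric angmetric u).
Proof. by rewrite angmetricE. Qed.

Lemma wfun_sqr u : wfun u ^+ 2 = qmetric angmetric u.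
Proof. by rewrite wfunE sqr_sqrtr // angmetric_ge0. Qed.

Lemma wfun_gt0 u : wfun u != 0 -> 0 < qmetric angmetric u.
Proof.
move=> w0; rewrite lt_neqAle angmetric_ge0 andbT eq_sym; apply: contraNneq w0 => E.
by rewrite wfunE E sqrtr0.
Qed.

Lemma smooth_pt (f : R -> R -> R) : smooth M (fun x : vec R => f (x 0 it) (x 0 ir)) ->
  smooth M (fun x : vec R => pt f (x 0 it) (x 0 ir)).
Proof.
move=> sf; rewrite (_ : (fun x : vec R => _) =
    fun x => 'D_(delta_mx 0 it) (fun y : vec R => f (y 0 it) (y 0 ir)) x).
  exact: smooth_derive.
by rewrite funeqE => x; have [-> _ _ _] := derive_tr f x.
Qed.

Lemma smooth_pr (f : R -> R -> R) : smooth M (fun x : vec R => f (x 0 it) (x 0 ir)) ->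
  smooth M (fun x : vec R => pr f (x 0 it) (x 0 ir)).
Proof.
move=> sf; rewrite (_ : (fun x : vec R => _) =
    fun x => 'D_(delta_mx 0 ir) (fun y : vec R => f (y 0 it) (y 0 ir)) x).
  exact: smooth_derive.
by rewrite funeqE => x; have [_ -> _ _] := derive_tr f x.
Qed.

Lemma smooth_curvature :
  [/\ smooth M (fun x : vec R => a1 K (x 0 it) (x 0 ir)),
      smooth M (fun x : vec R => a2 K (x 0 it) (x 0 ir)) &
      smooth M (fun x : vec R => a3 K (x 0 it) (x 0 ir))].
Proof.
have s1 := smooth_trcoef tfK 0 0 0; have s2 := smooth_trcoef tfK 0 1 0.
have s3 := smooth_trcoef tfK 1 1 0; have s4 := smooth_trcoef tfK 0 0 1.
have s5 := smooth_trcoef tfK 1 1 1; have s6 := smooth_trcoef tfK 0 1 1.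
have sD (f g : vec R -> R) : smooth M f -> smooth M g -> smooth M (fun x => f x + g x).
  by move=> sf sg n; exact: CnD.
have sM (f g : vec R -> R) : smooth M f -> smooth M g -> smooth M (fun x => f x * g x).
  by move=> sf sg n; exact: CnM.
have sN (f : vec R -> R) : smooth M f -> smooth M (fun x => - f x).
  by move=> sf n; exact: CnN.
rewrite /= in s1 s2 s3 s4 s5 s6.
have p2 := sM _ _ s2 s2; have p6 := sM _ _ s6 s6.
split.
- exact: (sD _ _ (sD _ _ (sD _ _ (smooth_pr s1) (sN _ (smooth_pt s2)))
    (sM _ _ s3 s4)) (sN _ (sM _ _ s2 s6))).
- exact: (sD _ _ (sD _ _ (sD _ _ (sD _ _ (sD _ _ (smooth_pr s2)
    (sN _ (smooth_pt s3))) p2) (sM _ _ s3 s6)) (sN _ (sM _ _ s1 s3)))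
    (sN _ (sM _ _ s2 s5))).
- exact: (sD _ _ (sD _ _ (sD _ _ (sD _ _ (sD _ _ (smooth_pr s4)
    (sN _ (smooth_pt s6))) (sM _ _ s1 s6)) (sM _ _ s4 s5))
    (sN _ (sM _ _ s2 s4))) (sN _ p6)).
Qed.

Lemma smooth_metcoef i j : smooth M (fun x : vec R => metcoef i j (x 0 it) (x 0 ir)).
Proof.
have [s1 s2 s3] := smooth_curvature.
have z : smooth M (fun _ : vec R => 0 : R) by move=> n; exact: Cn_cst.
case: i => [|[|i]] //; case: j => [|[|j]] //.
by move=> n; exact: CnN (s3 n).
Qed.

Lemma smooth_trmetric i j : smooth M (fun x => trmetric x i j).
Proof.
rewrite (_ : (fun x => _) = fun x : vec R => metcoef i j (x 0 it) (x 0 ir)).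
  exact: smooth_metcoef.
by rewrite funeqE => x; rewrite mxE.
Qed.

Lemma smooth_angmetric i j : smooth M (fun x => angmetric x i j).
Proof.
move=> n.
have z : Cn n M (fun _ : vec R => 0 : R) by exact: Cn_cst.
have o : Cn n M (fun _ : vec R => 1 : R) by exact: Cn_cst.
have s : Cn n M (fun x : vec R => sin (x 0 ith) ^+ 2).
  have [s _] := Cn_sin_cos oM (Cn_coord n M ith); exact: CnM.
rewrite (_ : (fun x => _) = fun x : vec R => match nat_of_ord i, nat_of_ord j with
  | 2%N, 2%N => 1
  | 3%N, 3%N => sin (x 0 ith) ^+ 2
  | _, _ => 0
  end); last by rewrite funeqE => x; rewrite mxE.
by move: i j; do 2![apply: ord4P].
Qed.

Lemma nablaE (S : vec R -> 'M[R]_4) G a x i j : nabla S G a x i j =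
  'D_(delta_mx 0 a) (fun y => S y i j) x + \sum_k conn G a x i k * S x k j
    + \sum_k S x i k * conn G a x j k.
Proof.
rewrite !mxE; congr (_ + _); apply: eq_bigr => k _; by rewrite mxE.
Qed.

(** Over [M] the angular part of the connection is the Levi-Civita connection of the round sphere,
    whose metric is w^2. *)
Lemma nabla_angmetric a x : M x -> nabla angmetric (sphG K) a x = 0.
Proof.
move=> Mx; have s0 := lt0r_neq0 (sin_chart_gt0 Mchart Mx).
have D i j : 'D_(delta_mx 0 a) (fun y => angmetric y i j) x =
   (a == ith)%:R * match nat_of_ord i, nat_of_ord j with
     3%N, 3%N => 2 * sin (x 0 ith) * cos (x 0 ith) | _, _ => 0 end.
  rewrite (_ : (fun y => _) = fun x : vec R => match nat_of_ord i, nat_of_ord j with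
    | 2%N, 2%N => 1
    | 3%N, 3%N => sin (x 0 ith) ^+ 2
    | _, _ => 0
    end); last by rewrite funeqE => y; rewrite mxE.
  have dc (c : R) : 'D_(delta_mx 0 a) (fun _ : vec R => c) x = 0 by exact: (derive_cst c).
  have dth : is_derive x (delta_mx 0 a) (fun y : vec R => y 0 ith : R) (a == ith)%:R.
    have := is_derive_entry 0 ith x (delta_mx 0 a); rewrite mxE eqxx /=.
    by rewrite eq_sym.
  have ds := is_derive_chain (is_derive_sin (x 0 ith)) dth.
  have dss := is_derive_lam_mul ds ds.
  move: i j; do 2![apply: ord4P]; rewrite /= ?mulr0 ?dc //.
  by rewrite (is_deriveE dss); ring.
have [e0 e1 e2 e3] := ord4_eqE.
apply/matrixP => i j; rewrite nablaE D !sum4 [RHS]mxE !(connE K0) // !mxE.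
move: a i j {D}; do 3![apply: ord4P]; rewrite ?e0 ?e1 ?e2 ?e3 /=.
all: move: s0; generalize (sin (x 0 ith)) (cos (x 0 ith)) => s c s0; by field.
Qed.

End BlockMetric.

(** * From the stationarity of q to the covariant derivative of Q *)

Section ConformalFactor.
Variables (R : realType) (M : set (vec R)) (A : set (tpt R)) (L : tpt R -> R)
  (K : sphcoef R).
Hypothesis HL : class5 M A L K.
Let oM : open M := class5_open HL.
Let Mchart := class5_chart HL.
Let tfK : torsion_free_connection M (sphG K) := (class5_conn HL).1.
Let K0 := class5_k HL.

Lemma nabla_trmetric_ang (a : 'I_4) x : (2 <= a)%N -> M x ->
  nabla (trmetric K) (sphG K) a x = 0.
Proof.
move=> a2 Mx; have D i j : 'D_(delta_mx 0 a) (fun y => trmetric K y i j) x = 0.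
  rewrite (_ : (fun y => _) = fun x : vec R => metcoef K i j (x 0 it) (x 0 ir)).
    by rewrite derive_dtr; move: a a2; apply: ord4P.
  by rewrite funeqE => y; rewrite mxE.
apply/matrixP => i j; rewrite nablaE D !sum4 [RHS]mxE !(connE K0) // !mxE.
have [e0 e1 e2 e3] := ord4_eqE.
by move: a i j a2 {D}; do 3![apply: ord4P] => //= _;
  rewrite !(mul0r, mulr0, addr0, add0r, oppr0).
Qed.

Variable vphi : R -> R -> R.
Hypothesis sphi : smooth M (fun x : vec R => vphi (x 0 it) (x 0 ir)).

Lemma open_gt0 (U : set (tpt R)) (f : tpt R -> R) : open U -> Cn 0 U f ->
  open [set v | U v /\ 0 < f v].
Proof.
move=> oU cf; rewrite openE => u [Uu fu].
have nU : \forall v \near u, U v by exact: near_open oU Uu _.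
have nf : \forall v \near u, 0 < f v.
  exact: (cf _ Uu _ (open_nbhs_nbhs (conj (@open_gt R 0) fu))).
exact: filterS2 nU nf.
Qed.

Lemma sqrt_expR_ln (z : R) : 0 < z -> Num.sqrt z = expR (2^-1 * ln z).
Proof.
move=> z0; have E : z = expR (2^-1 * ln z) ^+ 2.
  by rewrite -expRM_natl mulrA mulfV // mul1r lnK.
by rewrite {1}E sqrtr_sqr ger0_norm ?expR_ge0.
Qed.

(** Where Q and tdot have the signs [s] and [sg], the division by tdot inside the logarithm and the
    factor tdot outside cancel up to [sg]. The left-hand side, free of absolute values, roots and
    quotients of variables, is ready for the chain rule. *)
Lemma qfun_expR (s sg : R) v : s ^+ 2 = 1 -> sg ^+ 2 = 1 ->
  0 < s * Qform K v -> 0 < sg * v.2 0 it -> 0 < qmetric (@angmetric R) v ->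
  sg * expR (2^-1 * ln (s * Qform K v) - vphi (v.1 0 it) (v.1 0 ir)
    - 2^-1 * ln (qmetric (@angmetric R) v)) = qfun K vphi v.
Proof.
move=> s2 sg2 sQ sy W0; rewrite /qfun /Ifun wfunE sqrt_expR_ln //.
set n := sg * v.2 0 it in sy *; set t := v.1 0 it; set r := v.1 0 ir.
have y0E : v.2 0 it = sg * n by rewrite /n mulrA -expr2 sg2 mul1r.
have n0 := lt0r_neq0 sy.
have sg0 : sg != 0 by apply: contra_eq_neq sg2 => ->; rewrite expr0n /= eq_sym oner_eq0.
have arg : - a3 K t r + 2 * a1 K t r * (v.2 0 ir / v.2 0 it)
   + a2 K t r * (v.2 0 ir / v.2 0 it) ^+ 2 = Qform K v / n ^+ 2.
  have -> : n ^+ 2 = v.2 0 it ^+ 2 by rewrite /n exprMn sg2 mul1r.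
  have yy : v.2 0 it != 0 by rewrite y0E mulf_neq0.
  by rewrite /Qform -/t -/r; field.
have sN : `|s| = 1.
  by apply/eqP; rewrite -sqrp_eq1 // -normrX s2 normr1.
have QN : `|Qform K v| = s * Qform K v.
  by rewrite -[RHS]gtr0_norm // normrM sN mul1r.
rewrite arg normrM QN normfV [`|n ^+ 2|]ger0_norm ?sqr_ge0 //.
rewrite ln_div ?posrE ?exprn_gt0 // lnXn // mulrBr.
have -> : 2^-1 * (ln n *+ 2) = ln n by rewrite mulr2n; field.
rewrite !expRB lnK ?posrE // {1}y0E.
have e0 : expR (vphi t r) != 0 by rewrite expR_eq0.
have e1 : expR (2^-1 * ln (qmetric (@angmetric R) v)) != 0 by rewrite expR_eq0.
by field; rewrite e0 e1 n0.
Qed.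

(** Logarithmic differentiation of q: since delta_a annihilates w^2, half the logarithmic derivative
    of Q equals the derivative of [vphi]. *)
Lemma qfun_stationary a u : A u -> u.2 0 it != 0 -> wfun u != 0 -> Qform K u != 0 ->
  'D_(delta (sphG K) a u) (qfun K vphi) u = 0 ->
  qform (nabla (trmetric K) (sphG K) a u.1) u.2 =
  2 * 'D_(delta_mx 0 a) (fun x : vec R => vphi (x 0 it) (x 0 ir)) u.1
    * Qform K u.
Proof.
move=> Au y0 w0 Q0 Dq; have Mu := fibre_base HL Au.
have W0 := wfun_gt0 w0.
pose s := Num.sg (Qform K u); pose sg := Num.sg (u.2 0 it).
have s2 : s ^+ 2 = 1 by rewrite /s sqr_sg Q0.
have sg2 : sg ^+ 2 = 1 by rewrite /sg sqr_sg y0.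
have sQ : 0 < s * Qform K u by rewrite /s -normrEsg normr_gt0.
have sy : 0 < sg * u.2 0 it by rewrite /sg -normrEsg normr_gt0.
have oB := open_over oM; have smH := smooth_trmetric HL.
have smW := smooth_angmetric HL.
have C1 : Cn 0 [set v : tpt R | M v.1] (fun v => s * Qform K v).
  rewrite (_ : Qform K = qmetric (trmetric K)); last first.
    by rewrite funeqE => v; rewrite trmetricE.
  by apply: CnM => //; [exact: Cn_cst|exact: (smooth_qmetric oM smH)].
have C2 : Cn 0 [set v : tpt R | M v.1] (fun v => sg * v.2 0 it).
  by apply: CnM => //; [exact: Cn_cst|exact: Cn_fiber].
have C3 : Cn 0 [set v : tpt R | M v.1] (qmetric (@angmetric R)).
  exact: (smooth_qmetric oM smW).
(* Construction of the open set where Q and tdot keep their signs at [u] and w is nonzero;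
   [qfun_expR] holds on it. *)
have oU1 := open_gt0 oB C1; set U1 := [set v | _] in oU1.
have oU2 : open [set v | U1 v /\ 0 < sg * v.2 0 it].
  by apply: open_gt0 => //; apply: subset_Cn C2 => v [].
set U2 := [set v | _] in oU2.
have oU : open [set v | U2 v /\ 0 < qmetric (@angmetric R) v].
  by apply: open_gt0 => //; apply: subset_Cn C3 => v [[]].
have E v : (([set v : tpt R | M v.1] v /\ 0 < s * Qform K v) /\ 0 < sg * v.2 0 it) /\
    0 < qmetric (@angmetric R) v ->
    sg * expR (2^-1 * ln (s * Qform K v) - vphi (v.1 0 it) (v.1 0 ir)
    - 2^-1 * ln (qmetric (@angmetric R) v)) = qfun K vphi v.
  by move=> [[[_ v1] v2] v3]; exact: qfun_expR.
set d := delta (sphG K) a u in Dq.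
have dQ : is_derive u d (Qform K) (qform (nabla (trmetric K) (sphG K) a u.1) u.2).
  rewrite -(derive_delta_qmetric smH) //.
  rewrite (_ : Qform K = qmetric (trmetric K)); last first.
    by rewrite funeqE => v; rewrite trmetricE.
  exact: diff_is_derive (smooth_differentiable (smooth_qmetric oM smH) Mu).
have dW : is_derive u d (qmetric (@angmetric R)) 0.
  have := diff_is_derive d (smooth_differentiable (smooth_qmetric oM smW) Mu).
  rewrite /d (derive_delta_qmetric smW) // (nabla_angmetric HL) //.
  by rewrite qformE mulmx0 mul0mx mxE.
have dphi : is_derive u d (fun v : tpt R => vphi (v.1 0 it) (v.1 0 ir))
   ('D_(delta_mx 0 a) (fun x : vec R => vphi (x 0 it) (x 0 ir)) u.1).
  apply: (is_derive_fst (f := fun x : vec R => vphi (x 0 it) (x 0 ir))).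
  exact: diff_is_derive (smooth_differentiable sphi Mu).
have cst c := is_derive_lam_cst (c : R) u d.
have lnQ := is_derive_chain (h := @ln R) (f := fun v => s * Qform K v)
  (is_derive1_ln sQ) (is_derive_lam_mul (cst s) dQ).
have lnW := is_derive_chain (h := @ln R) (f := qmetric (@angmetric R)) (is_derive1_ln W0) dW.
have dg := is_derive_lam_add (is_derive_lam_add (is_derive_lam_mul (cst 2^-1) lnQ)
   (is_derive_lam_opp dphi)) (is_derive_lam_opp (is_derive_lam_mul (cst 2^-1) lnW)).
have de := is_derive_lam_mul (cst sg) (is_derive_chain (is_derive_expR _) dg).
have := is_deriveE (eq_is_derive_open oU
  (conj (conj (conj Mu sQ) sy) W0) E de).
rewrite Dq; set q := qform _ _; set D := 'D_ _ _ _.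
move=> /esym/eqP; rewrite !mul0r !add0r mulr0 mulr0 oppr0 addr0.
have sg0 : sg != 0 by apply: contra_eq_neq sg2 => ->; rewrite expr0n /= eq_sym oner_eq0.
rewrite !mulf_eq0 (negbTE sg0) expR_eq0 /= subr_eq0 => /eqP <-.
have s0 : s != 0 by apply: contra_eq_neq s2 => ->; rewrite expr0n /= eq_sym oner_eq0.
by field; rewrite s0 Q0.
Qed.

End ConformalFactor.

(** * Metrics with the given canonical connection *)

Section AffineEquivalence.
Variables (R : realType) (M : set (vec R)) (A : set (tpt R)) (L : tpt R -> R)
  (K : sphcoef R).
Hypothesis HL : class5 M A L K.
Let oM : open M := class5_open HL.
Let Mchart := class5_chart HL.
Let tfK : torsion_free_connection M (sphG K) := (class5_conn HL).1.
Let K0 := class5_k HL.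
Hypothesis trace0 : forall x : vec R, M x ->
  a1 K (x 0 it) (x 0 ir) + a4 K (x 0 it) (x 0 ir) = 0.
Variable vphi : R -> R -> R.
Hypothesis Hphi : class5_phi A L M K vphi.
Let sphi := Hphi.1.
Let phi (x : vec R) := vphi (x 0 it) (x 0 ir).

Lemma trmetric_det x : M x ->
  a1 K (x 0 it) (x 0 ir) ^+ 2 + a2 K (x 0 it) (x 0 ir) * a3 K (x 0 it) (x 0 ir) != 0.
Proof.
move=> Mx; have := curvature_det HL Mx.
have -> : a4 K (x 0 it) (x 0 ir) = - a1 K (x 0 it) (x 0 ir).
  by apply/eqP; rewrite -addr_eq0 addrC trace0.
by rewrite mulrN -opprD oppr_eq0 -expr2.
Qed.

Lemma trmetric_nonzero x : M x -> exists z, qform (trmetric K x) z != 0.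
Proof.
move=> Mx; apply: contrapT => H; have det := trmetric_det Mx.
have z0 z : qform (trmetric K x) z = 0.
  by apply: contrapT => /eqP zn; apply: H; exists z.
have E (z : vec R) : - a3 K (x 0 it) (x 0 ir) * z 0 it ^+ 2
   + 2 * a1 K (x 0 it) (x 0 ir) * z 0 it * z 0 ir
   + a2 K (x 0 it) (x 0 ir) * z 0 ir ^+ 2 = 0.
  exact: (etrans (esym (trmetricE K (x, z))) (z0 z)).
(* Two coordinate vectors and their sum determine the three coefficients. *)
have Et := E (delta_mx 0 it); have Er := E (delta_mx 0 ir).
have Etr := E (delta_mx 0 it + delta_mx 0 ir).
rewrite !mxE /= in Et Er Etr.
move: det Et Er Etr; generalize (a1 K (x 0 it) (x 0 ir)) (a2 K (x 0 it) (x 0 ir))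
  (a3 K (x 0 it) (x 0 ir)) => b1 b2 b3 det Et Er Etr.
have b30 : b3 = 0 by lra.
have b20 : b2 = 0 by lra.
have b10 : b1 = 0 by lra.
by rewrite b10 b20 mul0r expr0n addr0 eqxx in det.
Qed.

Lemma generic_direction x : M x ->
  exists O y, [/\ open O, O y & forall y', O y' -> [/\ A (x, y'), y' 0 it != 0,
    wfun (x, y') != 0 & Qform K (x, y') != 0]].
Proof.
move=> Mx; have [[oA _ onA _] _ _ _] := class5_finsler HL.
have [y0 Ay0] := onA x Mx; have oO := open_fibre (x := x) oA.
have s0 := lt0r_neq0 (sin_chart_gt0 Mchart Mx).
(* The form tdot^2; the conditions on tdot, w and Q are then imposed one after the other by
   [qform_dense]. *)
pose T : 'M[R]_4 := delta_mx it it.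
have TE y : qform T y = y 0 it ^+ 2.
  by rewrite /qform !sum4 !mxE /=; ring.
have T0 : qform T (delta_mx 0 it) != 0.
  by rewrite TE !mxE !eqxx expr1n oner_eq0.
have W0 : qform (angmetric x) (delta_mx 0 ith) != 0.
  have := angmetricE (x, delta_mx 0 ith); rewrite /qmetric /= => ->.
  by rewrite !mxE /= expr1n expr0n mul0r addr0 oner_eq0.
have [z Q0] := trmetric_nonzero Mx.
have [y1 Oy1 Ty1] := qform_dense oO Ay0 T0.
have oO1 := open_qform_neq0 (S := T) oO.
have [y2 Oy2 Wy2] := qform_dense oO1 (conj Oy1 Ty1) W0.
have oO2 := open_qform_neq0 (S := angmetric x) oO1.
have [y3 Oy3 Qy3] := qform_dense oO2 (conj Oy2 Wy2) Q0.
have oO3 := open_qform_neq0 (S := trmetric K x) oO2.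
exists [set y | [set y | [set y | [set y | A (x, y)] y /\ qform T y != 0] y /\
   qform (angmetric x) y != 0] y /\ qform (trmetric K x) y != 0], y3.
split=> // y' [[[Ay Ty] Wy] Qy]; split=> //.
- by move: Ty; rewrite TE expf_eq0.
- by rewrite wfunE sqrtr_eq0 -ltNge lt_neqAle angmetric_ge0 andbT eq_sym.
- by rewrite -trmetricE.
Qed.

(** Both sides are quadratic in [y]. For [a] equal to t or r they agree on an open part of the
    fibre, by the stationarity of q, and hence everywhere; in angular directions both vanish. *)
Lemma nabla_trmetric a x y : M x -> qform (nabla (trmetric K) (sphG K) a x) y =
  2 * 'D_(delta_mx 0 a) phi x * qform (trmetric K x) y.
Proof.
move=> Mx; have [a2|a2] := leqP 2 a.
  rewrite (nabla_trmetric_ang HL) // /phi derive_dtr qformE mulmx0 mul0mx mxE.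
  have -> : dtr a vphi (x 0 it) (x 0 ir) = 0 by move: a a2; apply: ord4P.
  by rewrite mulr0 mul0r.
have [U [y0 [oU Uy0 HU]]] := generic_direction Mx.
pose T := nabla (trmetric K) (sphG K) a x + - (2 * 'D_(delta_mx 0 a) phi x) *: trmetric K x.
have T0 : forall z, qform T z = 0; last first.
  by have := T0 y; rewrite /T qformD qformZ mulNr => /eqP; rewrite subr_eq0 => /eqP.
apply: (qform_open0 oU Uy0) => z /HU[Az z0 w0 Q0].
have [_ /(_ _ Az z0 w0 Q0)[Dt Dr _]] := Hphi.
have Da : 'D_(delta (sphG K) a (x, z)) (qfun K vphi) (x, z) = 0.
  exact: (ord2P (P := fun a => 'D_(delta (sphG K) a (x, z)) (qfun K vphi) (x, z) = 0)
    Dt Dr a2).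
have := qfun_stationary HL sphi Az z0 w0 Q0 Da.
rewrite /T qformD qformZ -trmetricE mulNr => /eqP; rewrite -subr_eq0 => /eqP E.
exact: E.
Qed.

Section Signed.
Variables (s C1 C2 : R).
Hypotheses (s2 : s ^+ 2 = 1) (C10 : C1 != 0) (C20 : C2 != 0).

Definition confactor (x : vec R) := s * C1 * expR (- 2 * vphi (x 0 it) (x 0 ir)).

(* With s = 1 or -1, this represents Ametric where 0 <= s * Qform. *)
Definition affmetric (x : vec R) : 'M[R]_4 :=
  confactor x *: trmetric K x + C2 *: angmetric x.

Lemma confactor_neq0 x : confactor x != 0.
Proof.
have s0 : s != 0 by apply: contra_eq_neq s2 => ->; rewrite expr0n /= eq_sym oner_eq0.
by rewrite /confactor mulf_neq0 ?expR_eq0 // mulf_neq0.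
Qed.

Lemma smooth_confactor : smooth M confactor.
Proof.
move=> n; apply: CnM => //; first exact: Cn_cst.
by apply: Cn_expR => //; apply: CnM; [exact: oM|exact: Cn_cst|exact: sphi].
Qed.

Lemma smooth_affmetric i j : smooth M (fun x => affmetric x i j).
Proof.
move=> n; rewrite (_ : (fun x => _) = fun x =>
    confactor x * trmetric K x i j + C2 * angmetric x i j); last first.
  by rewrite funeqE => x; rewrite !mxE.
apply: CnD => //; apply: CnM => //.
- exact: smooth_confactor.
- exact: (smooth_trmetric HL).
- exact: Cn_cst.
- exact: (smooth_angmetric HL).
Qed.

Lemma affmetric_sym x i j : affmetric x i j = affmetric x j i.
Proof. by rewrite !mxE; move: i j; do 2![apply: ord4P]. Qed.

(** Up to a nonzero factor, the determinant of the (t, r) block is that of the curvature block; the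
    angular block is diagonal with nonzero entries. *)
Lemma affmetric_unit x : M x -> affmetric x \in unitmx.
Proof.
move=> Mx; apply: unitmx_inj => v /rowP H.
have det := trmetric_det Mx; have c0 := confactor_neq0 x.
have s0 := lt0r_neq0 (sin_chart_gt0 Mchart Mx).
have Ht := H it; have Hr := H ir; have Hth := H ith; have Hph := H iph.
rewrite !mxE !sum4 !mxE /= !(mulr0, addr0, add0r, mul0r) in Ht Hr Hth Hph.
move: det Ht Hr; generalize (a1 K (x 0 it) (x 0 ir)) (a2 K (x 0 it) (x 0 ir))
  (a3 K (x 0 it) (x 0 ir)) => b1 b2 b3 det Ht Hr.
have {}Ht : v 0 it * - b3 + v 0 ir * b1 = 0.
  by apply: (mulfI c0); rewrite mulr0 -[RHS]Ht; ring.
have {}Hr : v 0 it * b1 + v 0 ir * b2 = 0.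
  by apply: (mulfI c0); rewrite mulr0 -[RHS]Hr; ring.
have vt : v 0 it = 0.
  apply: (mulfI det); rewrite mulr0.
  transitivity (b1 * (v 0 it * b1 + v 0 ir * b2) - b2 * (v 0 it * - b3 + v 0 ir * b1)).
    by ring.
  by rewrite Ht Hr !mulr0 subr0.
have vr : v 0 ir = 0.
  apply: (mulfI det); rewrite mulr0.
  transitivity (b1 * (v 0 it * - b3 + v 0 ir * b1) + b3 * (v 0 it * b1 + v 0 ir * b2)).
    by ring.
  by rewrite Ht Hr !mulr0 addr0.
have vth : v 0 ith = 0.
  by move/eqP: Hth; rewrite !mulf_eq0 (negbTE C20) /= ?oner_eq0 ?orbF => /eqP.
have vph : v 0 iph = 0.
  by move/eqP: Hph; rewrite !mulf_eq0 (negbTE C20) (negbTE s0) /= ?orbF => /eqP.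
by apply/rowP; apply: ord4P; rewrite mxE.
Qed.

(** Differentiating the factor exp(-2 vphi) produces exactly the term that cancels the right-hand
    side of [nabla_trmetric]; the angular part is parallel. *)
Lemma nabla_affmetric a x y : M x -> qform (nabla affmetric (sphG K) a x) y = 0.
Proof.
move=> Mx; pose e : vec R := delta_mx 0 a.
have dphi := diff_is_derive e (smooth_differentiable sphi Mx).
have dc : is_derive x e confactor (- 2 * 'D_e phi x * confactor x).
  have i1 := is_derive_lam_mul (is_derive_lam_cst (- 2 : R) x e) dphi.
  have i2 := is_derive_chain (h := @expR R)
    (f := fun x : vec R => - 2 * vphi (x 0 it) (x 0 ir)) (is_derive_expR _) i1.
  apply: is_derive_eq (is_derive_lam_mul (is_derive_lam_cst (s * C1) x e) i2) _.
  rewrite /confactor /phi; generalize ('D_e (fun x : vec R => vphi (x 0 it) (x 0 ir)) x) => d.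
  ring.
have -> : nabla affmetric (sphG K) a x =
    confactor x *: nabla (trmetric K) (sphG K) a x
    + (- 2 * 'D_e phi x * confactor x) *: trmetric K x
    + C2 *: nabla (@angmetric R) (sphG K) a x.
  have -> : nabla affmetric (sphG K) a x =
    (confactor x *: dmx e (trmetric K) x + (- 2 * 'D_e phi x * confactor x) *: trmetric K x
     + C2 *: dmx e (@angmetric R) x) + conn (sphG K) a x *m affmetric x
     + affmetric x *m (conn (sphG K) a x)^T.
    congr (_ + _ + _); apply/matrixP => i j.
    have entry3 (p q r : R) (m1 m2 m3 : 'M[R]_4) : (p *: m1 + q *: m2 + r *: m3) i j =
        p * m1 i j + q * m2 i j + r * m3 i j by rewrite !mxE.
    have dmxE (T : vec R -> 'M[R]_4) : dmx e T x i j = 'D_e (fun y => T y i j) x.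
      by rewrite mxE.
    have alg (p h q d w dw : R) : p * h + q * d + (0 * w + C2 * dw) = q * d + p * h + C2 * dw.
      by ring.
    rewrite entry3 !dmxE.
    have dH := diff_is_derive e (smooth_differentiable (smooth_trmetric HL i j) Mx).
    have dW := diff_is_derive e (smooth_differentiable (smooth_angmetric HL i j) Mx).
    have dS := is_derive_lam_add (is_derive_lam_mul dc dH)
      (is_derive_lam_mul (is_derive_lam_cst C2 x e) dW).
    have E z : M z -> confactor z * trmetric K z i j + C2 * angmetric z i j = affmetric z i j.
      by move=> _; rewrite !mxE.
    rewrite (is_deriveE (eq_is_derive_open oM Mx E dS)).
    exact: alg.
  rewrite /nabla /affmetric !mulmxDr !mulmxDl -!scalemxAr -!scalemxAl !scalerDr.
  have alg (p1 p2 p3 q1 q3 r1 r3 : 'M[R]_4) :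
      p1 + p2 + p3 + (q1 + q3) + (r1 + r3) = p1 + q1 + r1 + p2 + (p3 + q3 + r3).
    by apply/matrixP => i j; rewrite !mxE; ring.
  exact: alg.
rewrite !qformD !qformZ nabla_trmetric // (nabla_angmetric HL) //.
have -> : qform (0 : 'M[R]_4) y = 0 by rewrite qformE mulmx0 mul0mx mxE.
rewrite mulr0 addr0 -/e; generalize ('D_e phi x) => d; ring.
Qed.

Lemma derive_delta_affmetric a u : M u.1 ->
  'D_(delta (sphG K) a u) (qmetric affmetric) u = 0.
Proof.
by move=> Mu; rewrite (derive_delta_qmetric smooth_affmetric) // nabla_affmetric.
Qed.

Lemma affmetricE u : qmetric affmetric u = confactor u.1 * Qform K u + C2 * wfun u ^+ 2.
Proof. by rewrite /qmetric qformD !qformZ wfun_sqr -trmetricE. Qed.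

Lemma Ametric_affmetric u : 0 <= s * Qform K u ->
  Ametric K vphi C1 C2 u = qmetric affmetric u.
Proof.
move=> sQ; rewrite affmetricE /Ametric /confactor; congr (_ + _).
have s1 : `|s| = 1 by apply/eqP; rewrite -sqrp_eq1 // -normrX s2 normr1.
have -> : `|Qform K u| = s * Qform K u by rewrite -[RHS]ger0_norm // normrM s1 mul1r.
ring.
Qed.

Lemma canonical_affmetric : canonical_connection M (slit M) (qmetric affmetric) (sphG K).
Proof.
apply: (annihilates_canonical _ tfK) => [|a u [Mu _]].
  exact (finsler_qmetric oM smooth_affmetric (fun x i j _ => affmetric_sym x i j)
    affmetric_unit).
exact: derive_delta_affmetric.
Qed.

Lemma pseudo_riemannian_affmetric : pseudo_riemannian M (slit M) (qmetric affmetric).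
Proof.
exact (pseudo_riemannian_qmetric oM smooth_affmetric (fun x i j _ => affmetric_sym x i j)
  affmetric_unit).
Qed.

Lemma affinely_equivalent_affmetric :
  affinely_equivalent M A L (slit M) (qmetric affmetric).
Proof.
split; [exact: class5_finsler HL|exact: pseudo_riemannian_affmetric.1|].
by exists (sphG K); split; [exact: class5_conn HL|exact: canonical_affmetric].
Qed.

End Signed.

Lemma Qform_scale x y c : Qform K (x, c *: y) = c ^+ 2 * Qform K (x, y).
Proof. by rewrite -!trmetricE qmetric_homogeneous. Qed.

Lemma Cn0_signed_Qform (c : R) : Cn 0 [set u : tpt R | M u.1] (fun u => c * Qform K u).
Proof.
have -> : Qform K = qmetric (trmetric K) by rewrite funeqE => u; rewrite trmetricE.
apply: CnM; [exact: open_over oM|exact: Cn_cst|].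
exact: (smooth_qmetric oM (smooth_trmetric HL)).
Qed.

Definition Adom_sign (s : R) : set (tpt R) := [set u | M u.1 /\ 0 < s * Qform K u].

Lemma open_Adom_sign s : open (Adom_sign s).
Proof. exact (open_gt0 (open_over oM) (@Cn0_signed_Qform s)). Qed.

Lemma Adom_signU : Adom M K = Adom_sign 1 `|` Adom_sign (-1).
Proof.
rewrite predeqE => u; split=> [[Mu Q0]|[[Mu]|[Mu]]].
- have [Q|Q] := ltrP 0 (Qform K u); [left|right]; split=> //; first by rewrite mul1r.
  by rewrite mulN1r oppr_gt0 lt_neqAle Q0.
- by rewrite mul1r => Q; split=> //; exact: lt0r_neq0.
- by rewrite mulN1r oppr_gt0 => Q; split=> //; exact: ltr0_neq0.
Qed.

Lemma Adom_signP u : Adom M K u -> exists2 s : R, s ^+ 2 = 1 & Adom_sign s u.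
Proof.
by rewrite Adom_signU => -[|] H; [exists 1|exists (-1)] => //; rewrite ?sqrrN expr1n.
Qed.

(** * Gluing the two signs of Q *)

Section AbsoluteValue.
Variables (C1 C2 : R).
Hypotheses (C10 : C1 != 0) (C20 : C2 != 0).
Let B s := qmetric (affmetric s C1 C2).

Lemma Ametric_on_sign s : s ^+ 2 = 1 ->
  forall u, Adom_sign s u -> B s u = Ametric K vphi C1 C2 u.
Proof. by move=> s2 u [_ sQ]; rewrite (Ametric_affmetric _ _ s2) // ltW. Qed.

(** Smoothness and nondegeneracy are local, so they are inherited from [affmetric] on each open
    piece [Adom_sign s]; homogeneity comes from that of Q and w^2. *)
Lemma finsler_Ametric : finsler M (Adom M K) (Ametric K vphi C1 C2).
Proof.
split.
- split.
  + by rewrite Adom_signU; apply: openU; exact: open_Adom_sign.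
  + move=> [x y] [/= Mx Q0]; split=> //=; apply: contraNneq Q0 => ->.
    by rewrite -(scale0r 0) Qform_scale expr0n mul0r.
  + move=> x Mx; have [z Qz] := trmetric_nonzero Mx; exists z; split=> //.
    by rewrite -trmetricE.
  + move=> x y c c0 [/= Mx Q0]; split=> //.
    by rewrite Qform_scale mulf_neq0 // expf_neq0 // lt0r_neq0.
- move=> n; rewrite Adom_signU.
  have H s : s ^+ 2 = 1 -> Cn n (Adom_sign s) (Ametric K vphi C1 C2).
    move=> s2.
    have E : forall u, Adom_sign s u -> B s u = Ametric K vphi C1 C2 u.
      by move=> u Hu; exact: Ametric_on_sign.
    refine (@eq_Cn R _ _ n (Adom_sign s) (B s) _ (@open_Adom_sign s) E _).
    apply: (subset_Cn _ (smooth_qmetric oM (smooth_affmetric s C1 C2) n)).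
    by move=> u [].
  by apply: Cn_setU; apply: H; rewrite ?sqrrN expr1n.
- move=> x y c c0 _; rewrite /Ametric Qform_scale !wfun_sqr qmetric_homogeneous.
  by rewrite normrM ger0_norm ?sqr_ge0 //=; ring.
- move=> u /Adom_signP[s s2 Hu].
  have oU := @open_Adom_sign s.
  have E : forall v, Adom_sign s v -> B s v = Ametric K vphi C1 C2 v.
    by move=> v Hv; exact: Ametric_on_sign.
  have -> : fundamental_tensor (Ametric K vphi C1 C2) u = fundamental_tensor (B s) u.
    apply/matrixP => a b; rewrite [LHS]mxE [RHS]mxE; apply: (congr1 ( *%R 2^-1)).
    apply/esym.
    apply: (eq_derive_open _ oU Hu) => v Hv.
    exact: eq_derive_open oU Hv E.
  have [Mu _] := Hu.
  rewrite (fundamental_tensor_qmetric oM (smooth_affmetric s C1 C2)) //.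
    exact: affmetric_unit s2 C10 C20 _ Mu.
  by move=> x i j _; exact: affmetric_sym.
Qed.

Lemma affinely_equivalent_Ametric :
  affinely_equivalent M A L (Adom M K) (Ametric K vphi C1 C2).
Proof.
split; [exact: class5_finsler HL|exact: finsler_Ametric|].
exists (sphG K); split; first exact: class5_conn HL.
apply: annihilates_canonical finsler_Ametric tfK _ => a u /Adom_signP[s s2 Hu].
have [Mu _] := Hu.
have E : forall v, Adom_sign s v -> B s v = Ametric K vphi C1 C2 v.
  by move=> v Hv; exact: Ametric_on_sign.
rewrite -(eq_derive_open _ (@open_Adom_sign s) Hu E).
exact: derive_delta_affmetric.
Qed.

End AbsoluteValue.

End AffineEquivalence.

Unset Implicit Arguments.

Theorem lemma14 (R : realType) (M : set 'rV[R]_4)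
    (A : set ('rV[R]_4 * 'rV[R]_4)) (L : 'rV[R]_4 * 'rV[R]_4 -> R)
    (K : sphcoef R) (HL : class5 M A L K) :
  [/\ (forall x, M x -> let t := x 0 it in let r := x 0 ir in
         a1 K t r * a4 K t r - a2 K t r * a3 K t r != 0),
      (forall u, A u -> let t := u.1 0 it in let r := u.1 0 ir in
         [/\ a5 K t r = 0,
             ricci (sphG K) ir it u - ricci (sphG K) it ir u = a1 K t r + a4 K t r &
             (forall b c, ricci (sphG K) b c u = ricci (sphG K) c b u) <->
             a1 K t r + a4 K t r = 0]),
      ((forall x, M x -> a1 K (x 0 it) (x 0 ir) + a4 K (x 0 it) (x 0 ir) = 0) ->
       forall vphi : R -> R -> R, class5_phi A L M K vphi ->
       forall C1 C2 : R, C1 != 0 -> C2 != 0 ->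
         affinely_equivalent M A L (Adom M K) (Ametric K vphi C1 C2) /\
         forall s : R, s = 1 \/ s = -1 ->
           exists B : 'rV[R]_4 * 'rV[R]_4 -> R,
             [/\ pseudo_riemannian M (slit M) B,
                 (forall u, M u.1 -> 0 <= s * Qform K u ->
                    Ametric K vphi C1 C2 u = B u) &
                 affinely_equivalent M A L (slit M) B]) &
      (forall u, A u -> dim_le (vertical_part (sphG K) u) 2)].
Proof.
split.
- by move=> x Mx; exact (curvature_det HL Mx).
- move=> u /(fibre_base HL) Mu; split.
  + exact: (curvature_a5 HL Mu).
  + exact: (ricci_antisym HL Mu).
  + exact: (ricci_symP HL Mu).
- move=> tr0 vphi Hphi C1 C2 C10 C20; split.
    exact: (affinely_equivalent_Ametric HL tr0 Hphi C10 C20).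
  move=> s s1; have s2 : s ^+ 2 = 1 by case: s1 => ->; rewrite ?sqrrN expr1n.
  (* This metric is quadratic on all nonzero vectors over [M], so it continues [Ametric] smoothly
     across the zeros of Q. *)
  exists (qmetric (affmetric K vphi s C1 C2)); split.
  + exact: (pseudo_riemannian_affmetric HL tr0 Hphi s2 C10 C20).
  + by move=> u _ sQ; exact: Ametric_affmetric s2 _ sQ.
  + exact: (affinely_equivalent_affmetric HL tr0 Hphi s2 C10 C20).
- exact: (vertical_part_dim HL).
Qed.
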